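(* Fix $\gamma>0$ and let $\mu_0\in\mathcal P^0(\mathbb R)\cap\mathcal P_{\exp,\gamma}(\mathbb R)$ be an initial datum. Then, for any $p\ge1$, the unique measure weak solution $(\mu_t)_{t\ge0}$ to the dissipative Boltzmann equation associated to $\mu_0$ converges as $t\to\infty$ towards $\delta_0$ in the weak-$\star$ topology of $\mathcal P_p(\mathbb R)$ with the explicit rate $$W_p(\mu_t,\delta_0)\propto(1+C\,t)^{-\frac1\gamma}\qquad\text{as }t\to\infty,$$ for some positive constant $C$ depending on $\mu_0$.
   Context: Fix $a\in(0,1)$, $b=1-a$ and $\Upsilon=\max(\gamma,2)$. For $s\ge0$, $\|\mu\|_s:=\int_{\mathbb R}(1+x^2)^{s/2}|\mu|(dx)$; $\mathcal M_s^+(\mathbb R)$ is the set of nonnegative Borel measures on $\mathbb R$ with $\|\mu\|_s<\infty$. $\mathcal P_p(\mathbb R)$ is the set of Borel probability measures on $\mathbb R$ with finite $p$-th absolute moment; $\mathcal P^0(\mathbb R)$ denotes Borel probability measures with finite first moment and zero mean. $\mathcal P_{\exp,\gamma}(\mathbb R)$ is the set of probability measures $\mu$ for which there is $\varepsilon>0$ with $\int\exp(\varepsilon|x|^\gamma)\mu(dx)<\infty$. $\delta_0$ is the Dirac mass at $0$. $W_p$ is the Wasserstein distance of order $p$, $W_p(\mu,\nu)=\big(\inf_\pi\int_{\mathbb R^2}|x-y|^p\pi(dx,dy)\big)^{1/p}$ over couplings $\pi$ of $\mu$ and $\nu$; it metrizes the weak-$\star$ topology of $\mathcal P_p(\mathbb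 R)$ referred to in the claim. The symbol $\propto$, which the source does not define further, indicates the same order of decay, i.e. that the two sides are comparable up to positive multiplicative constants for large $t$. Collision operator: $\langle\mathcal Q(\mu,\nu);\varphi\rangle:=\frac12\int_{\mathbb R^2}|x-y|^\gamma\big(\varphi(ax+by)+\varphi(bx+ay)-\varphi(x)-\varphi(y)\big)\mu(dx)\nu(dy)$. Measure weak solution: given $\mu_0\in\mathcal M^+_\Upsilon(\mathbb R)$, a family $(\mu_t)_{t\ge0}\subset\mathcal M^+_\Upsilon(\mathbb R)$ is a measure weak solution to the dissipative Boltzmann equation $\partial_t\mu_t=\mathcal Q(\mu_t,\mu_t)$ associated to $\mu_0$ if: (1) $\sup_{t\ge0}\|\mu_t\|_\Upsilon\le\|\mu_0\|_\Upsilon$, and $\int\mu_t(dx)=\int\mu_0(dx)$, $\int x\,\mu_t(dx)=\int x\,\mu_0(dx)$ for all $t>0$; (2) for every bounded continuous $\varphi$ on $\mathbb R$, the map $t\mapsto\langle\mathcal Q(\mu_t,\mu_t);\varphi\rangle$ belongs to $C([0,\infty))\cap L^1_{\rm loc}([0,\infty))$ and, for all $t\ge0$, $\int\varphi\,d\mu_t=\int\varphi\,d\mu_0+\int_0^t\langle\mathcal Q(\mu_\tau,\mu_\tau);\varphi\rangle\,d\tau$. For $\mu_0\in\mathcal P^0(\mathbb R)\cap\mathcal P_{\exp,\gamma}(\mathbb R)$, the source establishes that a measure weak solution associated to $\mu_0$ exists and is unique; this is ''the unique measure weak solution'' of the claim.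
   Formalization: The lower bound in the rate ∝ is claimed only for μ0 ≠ δ_0, since for μ0 = δ_0 the solution stays δ_0 and W_p(μ_t,δ_0)=0; convergence and the upper rate bound are claimed for every μ0. *)

(* Defs.v *)
From HB Require Import structures.
From mathcomp Require Import all_boot all_order all_algebra.
From mathcomp Require Import all_classical all_reals all_analysis.

Set Implicit Arguments.
Unset Strict Implicit.
Unset Printing Implicit Defensive.

Import Order.TTheory GRing.Theory Num.Theory.
Import numFieldNormedType.Exports.

Local Open Scope classical_set_scope.
Local Open Scope ring_scope.

Definition Upsilon (R : realType) (gamma : R) : R := Num.max gamma 2.

Section measures.
Context {R : realType}.
Let rR := measurableTypeR R.
Implicit Types mu nu : {measure set rR -> \bar R}.

Definition meas_eq mu nu := forall A, measurable A -> mu A = nu A.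

(* All measures here are nonnegative, so |mu| = mu. *)
Definition moment_norm (s : R) mu : \bar R :=
  (\int[mu]_x ((1 + x ^+ 2) `^ (s / 2))%:E)%E.

Definition in_Pp (p : R) mu :=
  mu setT = 1%E /\ (\int[mu]_x (`|x| `^ p)%:E < +oo)%E.

Definition in_P0 mu :=
  [/\ mu setT = 1%E, (\int[mu]_x `|x|%:E < +oo)%E & \int[mu]_x x = 0].

Definition in_Pexp (gamma : R) mu :=
  mu setT = 1%E /\ exists2 eps : R, 0 < eps &
    (\int[mu]_x (expR (eps * `|x| `^ gamma))%:E < +oo)%E.

Definition is_coupling mu nu (pi : {measure set (rR * rR)%type -> \bar R}) :=
  (forall A, measurable A -> pi (A `*` setT) = mu A) /\
  (forall B, measurable B -> pi (setT `*` B) = nu B).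

Definition Wasserstein (p : R) mu nu : \bar R :=
  poweR
    (ereal_inf [set (\int[pi]_z (`|z.1 - z.2| `^ p)%:E)%E
               | pi in [set pi | is_coupling mu nu pi]])
    p^-1.

(* Convergence as t -> +oo in the weak-star topology of P_p: duality with the
   continuous functions of growth at most |x|^p. *)
Definition weak_star_cvg (p : R) (mu : R -> {measure set rR -> \bar R}) nu :=
  forall phi : R -> R, continuous phi ->
    (exists K, forall x, `|phi x| <= K * (1 + `|x| `^ p)) ->
    \int[mu t]_x phi x @[t --> +oo] --> \int[nu]_x phi x.

End measures.

Section boltzmann.
Context {R : realType}.
Let rR := measurableTypeR R.
Implicit Types a gamma : R.
Implicit Types mu : R -> {finite_measure set rR -> \bar R}.

Definition collision a gamma (mu nu : {finite_measure set rR -> \bar R})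
    (phi : R -> R) : R :=
  let b := 1 - a in
  2^-1 * \int[(mu \x nu)%E]_z
    (`|z.1 - z.2| `^ gamma *
     (phi (a * z.1 + b * z.2) + phi (b * z.1 + a * z.2) - phi z.1 - phi z.2)).

(* Only the values mu t with 0 <= t are constrained. *)
Definition measure_weak_solution a gamma (mu0 : {measure set rR -> \bar R}) mu :=
  [/\ (moment_norm (Upsilon gamma) mu0 < +oo)%E,
      (forall t, 0 <= t -> (moment_norm (Upsilon gamma) (mu t) < +oo)%E),
      (forall t, 0 <= t ->
         (moment_norm (Upsilon gamma) (mu t) <=
          moment_norm (Upsilon gamma) mu0)%E),
      (forall t, 0 < t ->
         mu t setT = mu0 setT /\ \int[mu t]_x x = \int[mu0]_x x) &
      forall phi : R -> R, continuous phi -> (exists K, forall x, `|phi x| <= K) ->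
        let q := fun t => collision a gamma (mu t) (mu t) phi in
        [/\ {within `[0, +oo[, continuous q},
            (forall T, 0 <= T ->
               (@lebesgue_measure R).-integrable `[0, T] (EFin \o q)) &
            forall t, 0 <= t ->
              \int[mu t]_x phi x =
              \int[mu0]_x phi x + \int[lebesgue_measure]_(s in `[0, t]) q s]].

Definition unique_measure_weak_solution a gamma (mu0 : {measure set rR -> \bar R})
    mu :=
  measure_weak_solution a gamma mu0 mu /\
  forall nu, measure_weak_solution a gamma mu0 nu ->
    forall t, 0 <= t -> meas_eq (nu t) (mu t).

End boltzmann.

Definition dominated_pinfty (R : realType) (f g : R -> \bar R) :=
  exists2 c : R, 0 < c & \forall t \near +oo, (f t <= c%:E * g t)%E.

Definition same_order_pinfty (R : realType) (f g : R -> \bar R) :=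
  dominated_pinfty f g /\ dominated_pinfty g f.

(* Main.v *)
Require Import Defs.
From HB Require Import structures.
From mathcomp Require Import all_boot all_order all_algebra.
From mathcomp Require Import all_classical all_reals all_analysis.
From mathcomp Require Import measurable_realfun.
From mathcomp Require Import ring lra.

(** Only bounded functions may be tested against a weak solution, so that nothing
    controls a priori the moments of a given one. By uniqueness, however, it is
    enough to construct one solution that cools at the right rate
    ([cooling_solution]).

    The construction applies explicit Euler steps to a discretized and centred
    initial datum. The iterates [euler] are finitely additive means, so that no
    question of integrability arises. Collisions bring particles together, so
    convex moments decrease; for [p >= 2], Clarkson's inequality gives a loss of
    at least a multiple of [|x - y|^p] in each collision ([gain_normr_powR]).
    As the mean vanishes, Jensen's inequality turns this into
    [z' <= - c z^2] for [z = (E |x|^p)^(gamma/p)], that is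
    [E |x|^p <= C (1 + t)^(- p/gamma)] ([euler_absp_decay]).

    For the lower bound, a collision costs [|x| + |y|] at most twice the smaller
    of the two ([gain_normr]), whence [m' >= - C m_gamma m] for the first moment
    [m]. The moment [m_gamma] is interpolated between [m] and a higher moment,
    which is of order [(1 + t)^(- q/gamma)]. Consequently
    [m (1 + t)^(1/gamma)] grows as soon as it is small, and it stays bounded
    away from zero if it is positive initially, that is if the initial datum is
    not the Dirac mass ([euler_normr_lower]).

    All bounds are uniform in the discretization. Limits along an ultrafilter
    exist for all times and test functions at once, and Helly's theorem
    represents them by probabilities ([helly]). The second order expansion of
    the scheme in time ([euler_taylor]) survives in the limit and integrates to
    the weak form of the equation ([taylor_integral]).

    Finally, the distance of order [p] to the Dirac mass is the [p]-th root of
    the moment of order [p] ([Wasserstein_dirac]), which lies above the first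
    moment by Jensen's inequality. *)

Set Implicit Arguments.
Unset Strict Implicit.
Unset Printing Implicit Defensive.

Import Order.TTheory GRing.Theory Num.Theory.
Import numFieldNormedType.Exports.

Local Open Scope classical_set_scope.
Local Open Scope ring_scope.

(** * Powers and weights *)
Section powers.
Context {R : realType}.
Implicit Types (s t u v x y p q l : R).

Lemma ler_powR_base s x y : 0 <= s -> 0 <= x -> x <= y -> x `^ s <= y `^ s.
Proof.
move=> s0 x0 xy.
by apply: ge0_ler_powR; rewrite ?nnegrE//; exact: le_trans xy.
Qed.

(** The tangent line inequality is Young's inequality
    [u v^(s-1) <= u^s / s + (1 - 1/s) v^s] read backwards; it is the only form
    of convexity of [u |-> u^s] used below. *)
Lemma powR_tangent s u v : 1 <= s -> 0 <= u -> 0 <= v ->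
  v `^ s + s * v `^ (s - 1) * (u - v) <= u `^ s.
Proof.
move=> s1 u0 v0.
have [->|sn1] := eqVneq s 1.
  by rewrite subrr powRr0 !powRr1//; lra.
have {sn1}s1' : 1 < s by rewrite lt_neqAle eq_sym sn1.
have s0 : 0 < s by lra.
have sm1 : 0 < s - 1 by lra.
have := @conjugate_powR _ u (v `^ (s - 1)) s (s / (s - 1)) u0 (powR_ge0 _ _) s0.
have q0 : 0 < s / (s - 1) by rewrite divr_gt0.
have sne : s != 0 by rewrite gt_eqF.
have sm1ne : s - 1 != 0 by rewrite gt_eqF.
have e : s^-1 + (s / (s - 1))^-1 = 1 by field; rewrite sne sm1ne.
move=> /(_ q0 e).
rewrite -powRrM (_ : (s - 1) * (s / (s - 1)) = s); last by field.
rewrite -(mulr_powRB1 v0 s0).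
set A := u `^ s; set B := v `^ (s - 1).
rewrite (_ : v * B / (s / (s - 1)) = v * B * (s - 1) / s); last first.
  by field; rewrite sne sm1ne.
rewrite -mulrDl ler_pdivlMr//; lra.
Qed.

Lemma powR_convex s x y l : 1 <= s -> 0 <= x -> 0 <= y -> 0 <= l <= 1 ->
  (l * x + (1 - l) * y) `^ s <= l * x `^ s + (1 - l) * y `^ s.
Proof.
move=> s1 x0 y0 /andP[l0 l1].
set w := l * x + (1 - l) * y.
have w0 : 0 <= w by rewrite addr_ge0 ?mulr_ge0// subr_ge0.
have := powR_tangent s1 x0 w0; have := powR_tangent s1 y0 w0.
set D := s * _ => hy hx.
have /(ler_wpM2l l0) := hx.
have l1' : 0 <= 1 - l by rewrite subr_ge0.
have /(ler_wpM2l l1') := hy.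
rewrite /w; nra.
Qed.

Lemma powR_convex_half s x y : 1 <= s -> 0 <= x -> 0 <= y ->
  2 * ((x + y) / 2) `^ s <= x `^ s + y `^ s.
Proof.
move=> s1 x0 y0.
have := @powR_convex s x y 2^-1 s1 x0 y0 ltac:(lra).
by rewrite (_ : 2^-1 * x + (1 - 2^-1) * y = (x + y) / 2); [lra|field].
Qed.

Lemma powR_superadd s x y : 1 <= s -> 0 <= x -> 0 <= y ->
  x `^ s + y `^ s <= (x + y) `^ s.
Proof.
move=> s1 x0 y0.
have s0 : 0 < s by lra.
have mon z w : 0 <= z -> z <= w -> z `^ s <= z * w `^ (s - 1).
  move=> z0 zw; rewrite -(mulr_powRB1 z0 s0) ler_wpM2l//.
  by apply: ler_powR_base => //; lra.
have xy0 : 0 <= x + y by lra.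
have := mon x (x + y) x0 ltac:(lra); have := mon y (x + y) y0 ltac:(lra).
by rewrite -(mulr_powRB1 xy0 s0); lra.
Qed.

Lemma normr_powR_sqr p x : `|x| `^ p = (x ^+ 2) `^ (p / 2).
Proof.
rewrite -real_normK ?num_real// -powR_mulrn// -powRrM.
by congr (_ `^ _); field.
Qed.

(** Clarkson's inequality with exponent at least two, the source of the
    quantitative dissipation of moments. *)
Lemma powR_clarkson p u v : 2 <= p ->
  2 * (`|u| `^ p + `|v| `^ p) <= `|u + v| `^ p + `|u - v| `^ p.
Proof.
move=> p2.
rewrite !normr_powR_sqr.
have h : 1 <= p / 2 by lra.
have := @powR_superadd (p / 2) (u ^+ 2) (v ^+ 2) h (sqr_ge0 _) (sqr_ge0 _).
have := @powR_convex_half (p / 2) ((u + v) ^+ 2) ((u - v) ^+ 2) h (sqr_ge0 _) (sqr_ge0 _).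
rewrite (_ : ((u + v) ^+ 2 + (u - v) ^+ 2) / 2 = u ^+ 2 + v ^+ 2); last by field.
lra.
Qed.

(** The weight [<x>^(2s)] with [<x>^2 = 1 + x^2]; unlike [|x|^p] it is bounded
    below, so that products of growth bounds are again growth bounds. *)
Definition wt s x := (1 + x ^+ 2) `^ s.

Lemma wtb_ge1 x : 1 <= 1 + x ^+ 2.
Proof. by rewrite lerDl sqr_ge0. Qed.

Lemma wtb_gt0 x : 0 < 1 + x ^+ 2.
Proof. exact: lt_le_trans ltr01 (wtb_ge1 x). Qed.

Lemma wt_gt0 s x : 0 < wt s x.
Proof. by rewrite powR_gt0// wtb_gt0. Qed.

Lemma wt_ge0 s x : 0 <= wt s x.
Proof. exact: powR_ge0. Qed.

Lemma wt_le s t x : s <= t -> wt s x <= wt t x.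
Proof. by move=> st; rewrite /wt ler_powR// wtb_ge1. Qed.

Lemma wt_ge1 s x : 0 <= s -> 1 <= wt s x.
Proof. by move=> s0; rewrite (le_trans _ (wt_le x s0))// /wt powRr0. Qed.

Lemma wtD s t x : wt (s + t) x = wt s x * wt t x.
Proof. by rewrite /wt powRD//; apply/implyP => _; rewrite gt_eqF ?wtb_gt0. Qed.

Lemma normr_powR_le_wt p x : 0 <= p -> `|x| `^ p <= wt (p / 2) x.
Proof.
move=> p0; rewrite normr_powR_sqr /wt.
by apply: ler_powR_base; rewrite ?sqr_ge0 ?lerDr//; lra.
Qed.

Lemma wt_sub s x y : 0 <= s -> wt s (x - y) <= 2 `^ s * (wt s x * wt s y).
Proof.
move=> s0; have w0 z : 0 <= 1 + z ^+ 2 := ltW (wtb_gt0 z).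
rewrite /wt -powRM// -powRM//; last exact: mulr_ge0.
apply: ler_powR_base => //.
rewrite -subr_ge0 (_ : _ - _ = 1 + (x + y) ^+ 2 + 2 * (x * y) ^+ 2); last by ring.
by have := sqr_ge0 (x + y); have := sqr_ge0 (x * y); lra.
Qed.

Lemma wt_even_le s x y : 0 <= s -> `|x| <= `|y| -> wt s x <= wt s y.
Proof.
move=> s0 xy; apply: ler_powR_base => //; first by rewrite ltW// wtb_gt0.
rewrite lerD2l.
by rewrite -[x ^+ 2]real_normK ?num_real// -[y ^+ 2]real_normK ?num_real// lerXn2r// nnegrE.
Qed.

Lemma wt_le_norm s x L : 0 <= s -> `|x| <= L -> wt s x <= wt s L.
Proof. by move=> s0 xL; rewrite wt_even_le// (le_trans xL)// ler_norm. Qed.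

End powers.

(** * The collision of two particles *)
Section collision_gain.
Context {R : realType} (a : R).
Hypothesis ha : 0 < a < 1.
Implicit Types (f : R -> R) (x y p g : R).

Definition gain f x y :=
  f (a * x + (1 - a) * y) + f ((1 - a) * x + a * y) - f x - f y.

(** The relative loss of relative velocity: outgoing particles lie at distance
    [(1 - inelasticity) |x - y|] of each other. *)
Definition inelasticity : R := 1 - `|2 * a - 1|.

Lemma inelasticity_gt0 : 0 < inelasticity.
Proof. by rewrite subr_gt0 ltr_norml; case/andP: ha => *; apply/andP; split; lra. Qed.

Lemma inelasticity_le1 : inelasticity <= 1.
Proof. by rewrite gerBl. Qed.

Lemma gain_wt s x y : 1 <= s -> gain (wt s) x y <= 0.
Proof.
move=> s1; case/andP: ha => a0 a1.
have H z w l : 0 <= l <= 1 ->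
    wt s (l * z + (1 - l) * w) <= l * wt s z + (1 - l) * wt s w.
  move=> l01.
  apply: le_trans (powR_convex s1 (ltW (wtb_gt0 z)) (ltW (wtb_gt0 w)) l01).
  rewrite /wt; apply: ler_powR_base; [lra|by rewrite ltW// wtb_gt0|].
  case/andP: l01 => l0 l1.
  rewrite -subr_ge0 (_ : _ - _ = l * (1 - l) * (z - w) ^+ 2); last by ring.
  by apply: mulr_ge0; rewrite ?sqr_ge0// mulr_ge0// subr_ge0.
have := H x y a ltac:(lra); have := H x y (1 - a) ltac:(lra).
rewrite /gain (_ : 1 - (1 - a) = a); last by ring.
lra.
Qed.

(** Write [x, y = m +- d]. The outgoing velocities are [m +- (1 - r) d], up to
    exchange, where [r] is the inelasticity: convex combinations of [m] with
    [x] and [y]. The gain is thus at most [r (2 |m|^p - |x|^p - |y|^p)], and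
    Clarkson's inequality bounds the bracket by [- 2 |d|^p]. *)
Lemma gain_normr_powR p x y : 2 <= p ->
  gain (fun z => `|z| `^ p) x y <= - (2 * inelasticity * (`|x - y| / 2) `^ p).
Proof.
move=> p2; case/andP: ha => a0 a1.
have p1 : 1 <= p by lra.
set m := (x + y) / 2; set d := (x - y) / 2.
have cvx l z w : 0 <= l <= 1 ->
    `|l * z + (1 - l) * w| `^ p <= l * `|z| `^ p + (1 - l) * `|w| `^ p.
  move=> l01; apply: le_trans (powR_convex p1 _ _ l01) => //.
  case/andP: l01 => l0 l1.
  apply: ler_powR_base => //; first lra.
  by rewrite (le_trans (ler_normD _ _))// !normrM (ger0_norm l0) (@ger0_norm _ (1 - l))// subr_ge0.
have r0 := inelasticity_gt0; have r1 := inelasticity_le1.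
have r01 : 0 <= inelasticity <= 1 by rewrite (ltW r0) r1.
have cl := powR_clarkson m d p2.
have ed : `|d| = `|x - y| / 2 by rewrite normrM (@ger0_norm _ 2^-1).
have ex : m + d = x by rewrite /m /d; field.
have ey : m - d = y by rewrite /m /d; field.
have key : `|a * x + (1 - a) * y| `^ p + `|(1 - a) * x + a * y| `^ p <=
    inelasticity * (2 * `|m| `^ p) + (1 - inelasticity) * (`|x| `^ p + `|y| `^ p).
  have := cvx inelasticity m x r01; have := cvx inelasticity m y r01.
  case: (lerP 0 (2 * a - 1)) => h.
    have er : inelasticity = 2 - 2 * a by rewrite /inelasticity ger0_norm//; ring.
    rewrite (_ : inelasticity * m + (1 - inelasticity) * x = a * x + (1 - a) * y); last first.
      by rewrite er /m; field.
    rewrite (_ : inelasticity * m + (1 - inelasticity) * y = (1 - a) * x + a * y); last first.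
      by rewrite er /m; field.
    lra.
  have er : inelasticity = 2 * a by rewrite /inelasticity ltr0_norm//; ring.
  rewrite (_ : inelasticity * m + (1 - inelasticity) * x = (1 - a) * x + a * y); last first.
    by rewrite er /m; field.
  rewrite (_ : inelasticity * m + (1 - inelasticity) * y = a * x + (1 - a) * y); last first.
    by rewrite er /m; field.
  lra.
rewrite /gain -ed; rewrite ex ey in cl.
have := ler_wpM2l (ltW r0) cl.
lra.
Qed.

(** Conservation of momentum bounds the outgoing [|x'| + |y'|] from below by
    [|x + y|]. *)
Lemma gain_normr x y : - (2 * Num.min `|x| `|y|) <= gain (fun z => `|z|) x y.
Proof.
have h : `|x + y| <= `|a * x + (1 - a) * y| + `|(1 - a) * x + a * y|.
  apply: le_trans (ler_normD _ _); rewrite le_eqVlt; apply/orP; left; apply/eqP.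
  by congr `|_|; ring.
have h1 : `|x| <= `|x + y| + `|y| by rewrite -{1}(addrK y x) ler_normB.
have h2 : `|y| <= `|x + y| + `|x| by rewrite -{1}(addrK x y) (addrC y) ler_normB.
by rewrite /gain; case: (leP `|x| `|y|) => _; lra.
Qed.

(** The loss is of the order of the slower particle, the collision rate of the
    order of the faster one to the power [g]: on average the loss is controlled
    by the product of the first moment and of the moment of order [g]. *)
Lemma rate_gain_normr g x y : 0 <= g ->
  - (2 * 2 `^ g * (`|x| `^ g * `|y| + `|y| `^ g * `|x|)) <=
  `|x - y| `^ g * gain (fun z => `|z|) x y.
Proof.
move=> g0.
have B0 : 0 <= `|x - y| `^ g by exact: powR_ge0.
apply: (@le_trans _ _ (`|x - y| `^ g * - (2 * Num.min `|x| `|y|))); last first.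
  by rewrite ler_wpM2l// gain_normr.
rewrite mulrN lerN2.
have bd M : `|x| <= M -> `|y| <= M -> `|x - y| `^ g <= 2 `^ g * M `^ g.
  move=> xM yM; have M0 : 0 <= M := le_trans (normr_ge0 _) xM.
  rewrite -powRM//; apply: ler_powR_base => //.
  by rewrite (le_trans (ler_normB _ _))//; lra.
have t0 : 0 <= 2 `^ g :> R by exact: powR_ge0.
have xg : 0 <= `|x| `^ g by exact: powR_ge0.
have yg : 0 <= `|y| `^ g by exact: powR_ge0.
case: (leP `|x| `|y|) => xy.
  have := bd `|y| xy (lexx _) => /(ler_wpM2r (normr_ge0 x)).
  have : 0 <= 2 `^ g * (`|x| `^ g * `|y|) by rewrite !mulr_ge0.
  lra.
have := bd `|x| (lexx _) (ltW xy) => /(ler_wpM2r (normr_ge0 y)).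
have : 0 <= 2 `^ g * (`|y| `^ g * `|x|) by rewrite !mulr_ge0.
lra.
Qed.

End collision_gain.

(** * Finitely additive means *)
Section means.
Context {R : realType}.
Implicit Types (L c s : R) (E : (R -> R) -> R) (f g : R -> R) (psi : R -> R -> R).

(** A finitely additive probability carried by [[-L, L]], seen as a functional
    on all functions. Being defined without any measurability requirement, it
    can be iterated in several variables and passed to limits pointwise. *)
Record is_mean L E : Prop := IsMean {
  mean_linear : forall c f g, E (fun x => c * f x + g x) = c * E f + E g;
  mean1 : E (fun=> 1) = 1;
  mean_le : forall f g, (forall x, `|x| <= L -> f x <= g x) -> E f <= E g }.

Definition mean2 E psi := E (fun x => E (psi x)).

Section mean_theory.
Variables (L : R) (E : (R -> R) -> R).
Hypothesis mE : is_mean L E.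

Lemma mean_ext f g : (forall x, `|x| <= L -> f x = g x) -> E f = E g.
Proof.
move=> fg; apply/eqP; rewrite eq_le.
by apply/andP; split; apply: (mean_le mE) => x /fg ->.
Qed.

Lemma mean0 : E (fun=> 0) = 0.
Proof.
have := mean_linear mE (- 1) (fun=> 1) (fun=> 1).
rewrite (mean1 mE) mulN1r addNr => e.
by rewrite -[RHS]e; apply: mean_ext => x _; ring.
Qed.

Lemma meanZ c f : E (fun x => c * f x) = c * E f.
Proof.
rewrite -[RHS]addr0 -mean0 -(mean_linear mE).
by apply: mean_ext => x _; rewrite addr0.
Qed.

Lemma meanD f g : E (fun x => f x + g x) = E f + E g.
Proof.
rewrite -[E f]mul1r -(mean_linear mE).
by apply: mean_ext => x _; rewrite mul1r.
Qed.

Lemma meanN f : E (fun x => - f x) = - E f.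
Proof. by rewrite -mulN1r -meanZ; apply: mean_ext => x _; rewrite mulN1r. Qed.

Lemma meanB f g : E (fun x => f x - g x) = E f - E g.
Proof. by rewrite meanD meanN. Qed.

Lemma mean_cst c : E (fun=> c) = c.
Proof.
by rewrite -[RHS]mulr1 -(mean1 mE) -meanZ; apply: mean_ext => x _; rewrite mulr1.
Qed.

Lemma mean_sum (I : Type) (r : seq I) (F : I -> R -> R) :
  E (fun x => \sum_(i <- r) F i x) = \sum_(i <- r) E (F i).
Proof.
elim: r => [|i r IH].
  by rewrite big_nil -[RHS]mean0; apply: mean_ext => x _; rewrite big_nil.
by rewrite big_cons -IH -meanD; apply: mean_ext => x _; rewrite big_cons.
Qed.

Lemma mean_ge0 f : (forall x, `|x| <= L -> 0 <= f x) -> 0 <= E f.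
Proof. by move=> f0; rewrite -mean0; exact: (mean_le mE). Qed.

Lemma mean_norm f g : (forall x, `|x| <= L -> `|f x| <= g x) -> `|E f| <= E g.
Proof.
move=> fg; rewrite ler_norml -meanN; apply/andP; split;
  by apply: (mean_le mE) => x /fg; rewrite ler_norml => /andP[].
Qed.

(** Integrate the tangent line inequality at the mean. *)
Lemma mean_jensen s f : 1 <= s -> (forall x, 0 <= f x) ->
  E f `^ s <= E (fun x => f x `^ s).
Proof.
move=> s1 f0; have Ef0 : 0 <= E f by apply: mean_ge0 => x _; exact: f0.
rewrite (_ : E f `^ s = E (fun x => s * E f `^ (s - 1) * (f x - E f) + E f `^ s)).
  by apply: (mean_le mE) => x _; rewrite addrC; exact: powR_tangent.
by rewrite (mean_linear mE) meanB !mean_cst subrr mulr0 add0r.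
Qed.

(** Conditionally on one of two independent centred variables, the other one
    only increases the moments of the difference. *)
Lemma mean_normB_ge s x : 1 <= s -> E id = 0 ->
  `|x| `^ s <= E (fun y => `|x - y| `^ s).
Proof.
move=> s1 E0.
pose D := s * `|x| `^ (s - 1) * Num.sg x.
rewrite (_ : `|x| `^ s = E (fun y => - D * y + `|x| `^ s)); last first.
  by rewrite (mean_linear mE) mean_cst E0 mulr0 add0r.
apply: (mean_le mE) => y _.
apply: le_trans (powR_tangent s1 (normr_ge0 (x - y)) (normr_ge0 x)).
rewrite addrC lerD2l /D mulNr -mulrN -mulrA -mulrA -!mulrA.
rewrite ler_wpM2l//; first lra.
rewrite ler_wpM2l ?powR_ge0//.
case: sgrP => x0.
- by rewrite mul0r subr0.
- rewrite mul1r; have := ler_norm (x - y); lra.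
- rewrite mulN1r; have := ler_norm (- (x - y)); rewrite normrN; lra.
Qed.

Lemma mean2_le psi psi' : (forall x y, `|x| <= L -> `|y| <= L -> psi x y <= psi' x y) ->
  mean2 E psi <= mean2 E psi'.
Proof. by move=> h; apply: (mean_le mE) => x xL; apply: (mean_le mE) => y; exact: h. Qed.

Lemma mean2_ext psi psi' : (forall x y, `|x| <= L -> `|y| <= L -> psi x y = psi' x y) ->
  mean2 E psi = mean2 E psi'.
Proof. by move=> h; apply: mean_ext => x xL; apply: mean_ext => y; exact: h. Qed.

Lemma mean2_linear c psi psi' :
  mean2 E (fun x y => c * psi x y + psi' x y) = c * mean2 E psi + mean2 E psi'.
Proof.
by rewrite -(mean_linear mE); apply: mean_ext => x _; rewrite (mean_linear mE).
Qed.

Lemma mean2Z c psi : mean2 E (fun x y => c * psi x y) = c * mean2 E psi.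
Proof. by rewrite -meanZ; apply: mean_ext => x _; rewrite meanZ. Qed.

Lemma mean2D psi psi' :
  mean2 E (fun x y => psi x y + psi' x y) = mean2 E psi + mean2 E psi'.
Proof. by rewrite -meanD; apply: mean_ext => x _; rewrite meanD. Qed.

Lemma mean2N psi : mean2 E (fun x y => - psi x y) = - mean2 E psi.
Proof. by rewrite -meanN; apply: mean_ext => x _; rewrite meanN. Qed.

Lemma mean2B psi psi' :
  mean2 E (fun x y => psi x y - psi' x y) = mean2 E psi - mean2 E psi'.
Proof. by rewrite mean2D mean2N. Qed.

Lemma mean2_fst f : mean2 E (fun x _ => f x) = E f.
Proof. by apply: mean_ext => x _; rewrite mean_cst. Qed.

Lemma mean2_snd f : mean2 E (fun _ y => f y) = E f.
Proof. exact: mean_cst. Qed.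

Lemma mean2M f g : mean2 E (fun x y => f x * g y) = E f * E g.
Proof.
rewrite [RHS]mulrC -meanZ; apply: mean_ext => x _.
by rewrite meanZ mulrC.
Qed.

Lemma mean2_norm psi psi' :
  (forall x y, `|x| <= L -> `|y| <= L -> `|psi x y| <= psi' x y) ->
  `|mean2 E psi| <= mean2 E psi'.
Proof. by move=> h; apply: mean_norm => x xL; apply: mean_norm => y; exact: h. Qed.

Lemma mean2_ge0 psi :
  (forall x y, `|x| <= L -> `|y| <= L -> 0 <= psi x y) -> 0 <= mean2 E psi.
Proof. by move=> h; apply: mean_ge0 => x xL; apply: mean_ge0 => y; exact: h. Qed.

End mean_theory.
End means.

(** * The explicit Euler scheme *)
Section scheme.
Context {R : realType} (a gamma : R).
Hypotheses (ha : 0 < a < 1) (hgamma : 0 < gamma).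
Implicit Types (L h c s K : R) (E : (R -> R) -> R) (f g : R -> R) (psi : R -> R -> R).

Definition rate_gain f x y : R := `|x - y| `^ gamma * gain a f x y.

Definition euler_step h E f : R := E f + h / 2 * mean2 E (rate_gain f).

Let kappa : R := 4 * 2 `^ (gamma / 2).

Let kappa_ge0 : 0 <= kappa.
Proof. by rewrite mulr_ge0// powR_ge0. Qed.

Lemma rate_gain_bound K s f : 1 <= s -> (forall x, `|f x| <= K * wt s x) ->
  forall x y, `|rate_gain f x y| <=
    K * kappa * (wt (s + gamma / 2) x * wt (s + gamma / 2) y).
Proof.
move=> s1 fK x y; have g0 := hgamma.
have K0 : 0 <= K.
  by rewrite -(pmulr_lge0 _ (wt_gt0 s 0)) (le_trans (normr_ge0 _) (fK 0)).
have g2 : 0 <= gamma / 2 by lra.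
rewrite /rate_gain normrM (ger0_norm (powR_ge0 _ _)).
have h1 : `|gain a f x y| <= 4 * K * (wt s x * wt s y).
  have w := gain_wt ha x y s1.
  have wx1 : 1 <= wt s x by apply: wt_ge1; lra.
  have wy1 : 1 <= wt s y by apply: wt_ge1; lra.
  apply: (@le_trans _ _ (2 * K * (wt s x + wt s y))); last first.
    rewrite (_ : 4 * K = 2 * K * 2); last by ring.
    by rewrite -[_ * 2 * _]mulrA ler_wpM2l ?mulr_ge0//; nra.
  rewrite /gain in w *.
  have := fK (a * x + (1 - a) * y); have := fK ((1 - a) * x + a * y).
  have := fK x; have := fK y; rewrite !ler_norml.
  move=> /andP[? ?] /andP[? ?] /andP[? ?] /andP[? ?].
  have := ler_wpM2l K0 w.
  by move=> ?; apply/andP; split; lra.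
have h2 : `|x - y| `^ gamma <= 2 `^ (gamma / 2) * (wt (gamma / 2) x * wt (gamma / 2) y).
  exact: le_trans (normr_powR_le_wt _ (ltW hgamma)) (wt_sub _ _ g2).
apply: le_trans (ler_pM (powR_ge0 _ _) (normr_ge0 _) h2 h1) _.
rewrite !wtD /kappa le_eqVlt; apply/orP; left; apply/eqP; ring.
Qed.

Section one_step.
Variables (L h : R) (E : (R -> R) -> R).
Hypotheses (mE : is_mean L E) (h0 : 0 <= h) (hL : h * (2 * L) `^ gamma <= 1).

(** Under the restriction on [h] the step redistributes a fraction
    [h |x - y|^gamma <= 1] of each pair of particles, so it preserves
    positivity; convexity of [[-L, L]] keeps the outgoing particles inside. *)
Lemma euler_step_mean : is_mean L (euler_step h E).
Proof.
case/andP: ha => a0 a1; have g0 := hgamma.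
split.
- move=> c f g; rewrite /euler_step (mean_linear mE).
  rewrite (mean2_ext mE (psi' := fun x y => c * rate_gain f x y + rate_gain g x y)).
    by rewrite (mean2_linear mE); ring.
  by move=> x y _ _; rewrite /rate_gain /gain; ring.
- rewrite /euler_step (mean1 mE) (mean2_ext mE (psi' := fun _ _ => 0)).
    by rewrite (mean2_fst mE) (mean0 mE) mulr0 addr0.
  by move=> x y _ _; rewrite /rate_gain /gain; ring.
- move=> f g fg.
  have eq_step u : euler_step h E u = mean2 E (fun x y =>
      2^-1 * ((1 - h * `|x - y| `^ gamma) * (u x + u y) + h * `|x - y| `^ gamma *
      (u (a * x + (1 - a) * y) + u ((1 - a) * x + a * y)))).
    rewrite (mean2_ext mE (psi' := fun x y =>
      (2^-1 * u x + 2^-1 * u y) + h / 2 * rate_gain u x y)); last first.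
      by move=> x y _ _; rewrite /rate_gain /gain; ring.
    rewrite (mean2D mE) (mean2Z mE) (mean2D mE) (mean2_fst mE) (mean2_snd mE) (meanZ mE).
    by rewrite /euler_step; congr (_ + _); field.
  rewrite !eq_step; apply: (mean2_le mE) => x y xL yL.
  have B0 : 0 <= h * `|x - y| `^ gamma by rewrite mulr_ge0// powR_ge0.
  have B1 : h * `|x - y| `^ gamma <= 1.
    apply: le_trans hL; rewrite ler_wpM2l//; apply: ler_powR_base => //; first lra.
    by rewrite (le_trans (ler_normB _ _))//; lra.
  have inL l z w : 0 <= l <= 1 -> `|z| <= L -> `|w| <= L -> `|l * z + (1 - l) * w| <= L.
    case/andP=> l0 l1; rewrite !ler_norml => /andP[? ?] /andP[? ?].
    by apply/andP; split; nra.
  have := fg _ (inL a x y ltac:(lra) xL yL).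
  have := fg _ (inL (1 - a) x y ltac:(lra) xL yL).
  rewrite (_ : 1 - (1 - a) = a); last by ring.
  move: (fg x xL) (fg y yL) => fgx fgy fg1 fg2.
  rewrite ler_wpM2l//; apply: lerD; rewrite ler_wpM2l//; lra.
Qed.

Lemma euler_step_le f : (forall x y, gain a f x y <= 0) -> euler_step h E f <= E f.
Proof.
move=> f0; rewrite gerDl mulr_ge0_le0//; first by rewrite divr_ge0.
rewrite -oppr_ge0 -(mean2N mE); apply: (mean2_ge0 mE) => x y _ _.
by rewrite -mulrN mulr_ge0 ?powR_ge0// oppr_ge0.
Qed.

Lemma euler_step_id : euler_step h E id = E id.
Proof.
rewrite /euler_step (mean2_ext mE (psi' := fun _ _ => 0)).
  by rewrite (mean2_fst mE) (mean0 mE) mulr0 addr0.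
by move=> x y _ _; rewrite /rate_gain /gain /=; ring.
Qed.

Lemma euler_step_near K s f : 1 <= s -> (forall x, `|f x| <= K * wt s x) ->
  `|euler_step h E f - E f| <= h * (K * kappa * (E (wt (s + gamma / 2))) ^+ 2).
Proof.
move=> s1 fK; rewrite addrC addKr normrM ger0_norm ?divr_ge0//.
have := mean2_norm mE (fun x y _ _ => rate_gain_bound s1 fK x y).
rewrite (mean2Z mE) (mean2M mE) -expr2 => H.
rewrite -[h / 2 * _]mulrA ler_wpM2l//.
have := normr_ge0 (mean2 E (rate_gain f)); lra.
Qed.

End one_step.

Section iteration.
Variables (L h : R) (E0 : (R -> R) -> R) (A : R -> R).
Hypotheses (mE0 : is_mean L E0) (h0 : 0 <= h) (hL : h * (2 * L) `^ gamma <= 1).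
Hypothesis (momA : forall s, 1 <= s -> E0 (wt s) <= A s).

Definition euler k := iter k (euler_step h) E0.

Lemma euler_mean k : is_mean L (euler k).
Proof. by elim: k => [//|k IH] /=; exact: euler_step_mean. Qed.
Let mE := euler_mean.

Lemma euler_noninc f k : (forall x y, gain a f x y <= 0) -> euler k f <= E0 f.
Proof.
move=> f0; elim: k => [//|k IH] /=; apply: le_trans IH.
exact: (euler_step_le (mE k) h0).
Qed.

Lemma euler_id k : euler k id = E0 id.
Proof. by elim: k => [//|k IH] /=; rewrite (euler_step_id _ (mE k)). Qed.

Lemma euler_wt k s : 1 <= s -> euler k (wt s) <= A s.
Proof.
move=> s1; apply: le_trans (momA s1).
by apply: euler_noninc => x y; exact: gain_wt.
Qed.

Let euler_wt_ge0 k s : 0 <= euler k (wt s).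
Proof. by apply: (mean_ge0 (mE k)) => x _; exact: wt_ge0. Qed.

Let A_ge0 s : 1 <= s -> 0 <= A s.
Proof. by move=> s1; exact: le_trans (euler_wt_ge0 0 s) (euler_wt 0 s1). Qed.

(** Uniform bound on the velocity of the scheme against test functions
    dominated by [wt s]; a collision rate costs [gamma / 2] more in the weight. *)
Definition euler_lip s := kappa * A (s + gamma / 2) ^+ 2.

Lemma euler_lipschitz K s f i d : 1 <= s -> (forall x, `|f x| <= K * wt s x) ->
  `|euler (i + d) f - euler i f| <= d%:R * h * (K * euler_lip s).
Proof.
move=> s1 fK; have g0 := hgamma.
have K0 : 0 <= K.
  by rewrite -(pmulr_lge0 _ (wt_gt0 s 0)) (le_trans (normr_ge0 _) (fK 0)).
elim: d => [|d IH]; first by rewrite addn0 subrr normr0 !mul0r.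
rewrite addnS (_ : _ - _ = (euler (i + d).+1 f - euler (i + d) f) +
  (euler (i + d) f - euler i f)); last by rewrite addrA subrK.
apply: le_trans (ler_normD _ _) _.
rewrite -[d.+1]add1n natrD !mulrDl mul1r; apply: lerD => //.
have := euler_step_near (mE (i + d)) h0 s1 fK; move/le_trans; apply.
rewrite ler_wpM2l// -[K * kappa * _]mulrA ler_wpM2l// ler_wpM2l//.
by rewrite lerXn2r ?nnegrE ?A_ge0 ?euler_wt//; lra.
Qed.

Lemma mean2_euler_lipschitz K s psi i d : 1 <= s ->
  (forall x y, `|psi x y| <= K * (wt s x * wt s y)) ->
  `|mean2 (euler (i + d)) psi - mean2 (euler i) psi| <=
    d%:R * h * (2 * K * A s * euler_lip s).
Proof.
move=> s1 pK; have g0 := hgamma.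
have K0 : 0 <= K.
  rewrite -(pmulr_lge0 _ (mulr_gt0 (wt_gt0 s 0) (wt_gt0 s 0))).
  exact: le_trans (normr_ge0 _) (pK 0 0).
set j := (i + d)%N; set l := d%:R * h.
have l0 : 0 <= l by rewrite mulr_ge0.
rewrite (_ : _ - _ = euler j (fun x => euler j (psi x) - euler i (psi x)) +
   (euler j (fun x => euler i (psi x)) - euler i (fun x => euler i (psi x)))); last first.
  by rewrite (meanB (mE j)) addrA subrK.
have lip0 : 0 <= euler_lip s by rewrite mulr_ge0// sqr_ge0.
rewrite (_ : 2 * K * A s * _ = K * A s * euler_lip s + K * A s * euler_lip s); last by ring.
rewrite mulrDr; apply: le_trans (ler_normD _ _) (lerD _ _).
  apply: le_trans (mean_norm (mE j) (g := fun x => l * (K * euler_lip s) * wt s x) _) _.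
    move=> x _; rewrite (_ : _ * wt s x = d%:R * h * (K * wt s x * euler_lip s)); last first.
      by rewrite /l; ring.
    by apply: euler_lipschitz => // y; rewrite -mulrA.
  rewrite (meanZ (mE j)) (_ : l * (K * A s * _) = l * (K * euler_lip s) * A s); last by ring.
  by rewrite ler_wpM2l ?euler_wt// mulr_ge0// mulr_ge0.
rewrite /l; apply: euler_lipschitz => // x.
apply: le_trans (mean_norm (mE i) (g := fun y => K * wt s x * wt s y) _) _.
  by move=> y _; rewrite -mulrA.
rewrite (meanZ (mE i)) (_ : K * A s * wt s x = K * wt s x * A s); last by ring.
by rewrite ler_wpM2l ?euler_wt// mulr_ge0// wt_ge0.
Qed.

(** Uniform bound on the second time derivative, where the collision operator is
    applied twice. *)
Definition euler_curv s :=
  kappa * A (s + gamma / 2) * euler_lip (s + gamma / 2).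

Lemma euler_taylor K s f i d : 1 <= s -> (forall x, `|f x| <= K * wt s x) ->
  `|euler (i + d) f - euler i f - d%:R * h * (2^-1 * mean2 (euler i) (rate_gain f))| <=
    (d%:R * h) ^+ 2 * (K * euler_curv s).
Proof.
move=> s1 fK; have g0 := hgamma.
have K0 : 0 <= K.
  by rewrite -(pmulr_lge0 _ (wt_gt0 s 0)) (le_trans (normr_ge0 _) (fK 0)).
have s1' : 1 <= s + gamma / 2 by lra.
have c0 : 0 <= K * euler_curv s.
  apply: mulr_ge0 => //; apply: mulr_ge0; first by rewrite mulr_ge0// A_ge0.
  by apply: mulr_ge0 => //; exact: sqr_ge0.
elim: d => [|d IH]; first by rewrite addn0 subrr !mul0r subr0 normr0 expr0n mul0r.
set q := mean2 (euler i) _ in IH *.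
have st : euler (i + d.+1) f = euler (i + d) f + h / 2 * mean2 (euler (i + d)) (rate_gain f).
  by rewrite addnS.
have lp := mean2_euler_lipschitz i d s1' (rate_gain_bound s1 fK).
rewrite (_ : _ - _ - _ = (euler (i + d) f - euler i f - d%:R * h * (2^-1 * q)) +
   h / 2 * (mean2 (euler (i + d)) (rate_gain f) - q)); last first.
  by rewrite st -[d.+1]addn1 natrD; field.
have bd : `|h / 2 * (mean2 (euler (i + d)) (rate_gain f) - q)| <=
    d%:R * h ^+ 2 * (K * euler_curv s).
  rewrite normrM ger0_norm ?divr_ge0//.
  rewrite (_ : _ * (K * _) = h / 2 * (d%:R * h *
    (2 * (K * kappa) * A (s + gamma / 2) * euler_lip (s + gamma / 2)))); last first.
    by rewrite /euler_curv; field.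
  by rewrite ler_wpM2l ?divr_ge0.
apply: le_trans (ler_normD _ _) (le_trans (lerD IH bd) _).
rewrite -[d.+1]addn1 natrD.
rewrite -mulrDl ler_wpM2r//.
rewrite -subr_ge0 (_ : _ - _ = h ^+ 2 * (d%:R + 1)); last by ring.
by apply: mulr_ge0; rewrite ?sqr_ge0// addr_ge0.
Qed.

End iteration.
End scheme.

(** * Cooling rates along the scheme *)
Section scalar_estimates.
Context {R : realType}.
Implicit Types (u t r c h z : R).

(** To first order this says [r <= 1/g]; the factor four pays for
    [exp (- 2 u) <= 1 - u] and [exp (t / 2) <= 1 + t], valid for
    [u <= 1/2] and [t <= 1]. *)
Lemma decay_vs_growth g r t : 0 < g -> 0 <= r -> r <= 2^-1 -> r * (4 * g) <= 1 ->
  0 <= t <= 1 -> 1 <= (1 - r * t) * (1 + t) `^ g^-1.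
Proof.
move=> g0 r0 r1 rg /andP[t0 t1].
have rt0 : 0 <= r * t by rewrite mulr_ge0.
have rt1 : r * t <= 2^-1 by nra.
have e1 : expR (- (2 * (r * t))) <= 1 - r * t.
  have h := expR_ge1Dx (2 * (r * t)).
  rewrite expRN -(ler_pM2l (expR_gt0 (2 * (r * t)))) mulfV ?gt_eqF ?expR_gt0//.
  have : (1 + 2 * (r * t)) * (1 - r * t) <= expR (2 * (r * t)) * (1 - r * t).
    by rewrite ler_wpM2r//; lra.
  nra.
have e2 : expR (t / 2) <= 1 + t.
  have h := expR_ge1Dx (- (t / 2)).
  rewrite -(ler_pM2l (expR_gt0 (- (t / 2)))) -expRD addNr expR0.
  have : (1 - t / 2) * (1 + t) <= expR (- (t / 2)) * (1 + t).
    by rewrite ler_wpM2r//; lra.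
  nra.
have e3 : expR (t / 2 / g) <= (1 + t) `^ g^-1.
  rewrite [expR _](_ : _ = expR (t / 2) `^ g^-1).
    by apply: ler_powR_base; rewrite ?expR_ge0// invr_ge0 ltW.
  by rewrite -expRM.
apply: le_trans (ler_pM (expR_ge0 _) (expR_ge0 _) e1 e3).
rewrite -expRD -[leLHS]expR0 ler_expR.
rewrite (_ : _ + _ = t * (1 - r * (4 * g)) / (2 * g)); last by field; rewrite gt_eqF.
by rewrite divr_ge0// ?mulr_ge0 ?subr_ge0// ltW.
Qed.

(** For [u] below [eta^(1/g)] or above [eta^(-1/2)] the first term suffices. *)
Lemma powR_interpolation g eta : 0 < g -> 0 < eta ->
  exists2 C : R, 0 < C & forall u, 0 <= u ->
    u `^ g <= eta * (1 + u `^ (g + 2)) + C * u.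
Proof.
move=> g0 e0.
pose s := eta `^ g^-1; pose S := eta `^ (- 2^-1).
have s0 : 0 < s by exact: powR_gt0.
have S0 : 0 < S by exact: powR_gt0.
exists (S `^ g / s); first by rewrite divr_gt0// powR_gt0.
move=> u u0.
have ug : 0 <= u `^ g by exact: powR_ge0.
have ug2 : 0 <= u `^ (g + 2) by exact: powR_ge0.
have C0 : 0 <= S `^ g / s * u by rewrite mulr_ge0// divr_ge0// ?powR_ge0// ltW.
have [us|su] := leP u s.
  have : u `^ g <= eta.
    rewrite -[leRHS](powRr1 (ltW e0)) -(@mulVf _ g) ?gt_eqF// powRrM.
    by apply: ler_powR_base => //; exact: ltW.
  by have := mulr_ge0 (ltW e0) ug2; lra.
have [uS|Su] := leP u S.
  have h1 : u `^ g <= S `^ g by apply: ler_powR_base => //; exact: ltW.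
  have h2 : S `^ g <= S `^ g / s * u.
    by rewrite -mulrA ler_peMr ?powR_ge0// mulrC ler_pdivlMr// mul1r ltW.
  have := mulr_ge0 (ltW e0) ug2; lra.
have h1 : eta * u ^+ 2 >= 1.
  have : S ^+ 2 <= u ^+ 2 by rewrite lerXn2r ?nnegrE// ltW.
  rewrite /S -powR_mulrn ?powR_ge0// -powRrM mulNr mulVf ?pnatr_eq0//.
  rewrite (powR_inv1 (ltW e0)) => h.
  by have := ler_wpM2l (ltW e0) h; rewrite mulfV// gt_eqF.
have -> : u `^ (g + 2) = u `^ g * u ^+ 2.
  rewrite powRD; last by apply/implyP => _; rewrite gt_eqF// (lt_trans s0).
  by rewrite powR_mulrn.
have := ler_wpM2l ug h1; rewrite mulr1; lra.
Qed.

End scalar_estimates.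

Section cooling.
Context {R : realType} (a gamma : R).
Hypotheses (ha : 0 < a < 1) (hgamma : 0 < gamma).
Implicit Types (L h p B m : R) (E : (R -> R) -> R).

Local Notation absp p := (fun x : R => `|x| `^ p).
Local Notation step := (euler_step a gamma).

Section one_step.
Variables (L h : R) (E : (R -> R) -> R).
Hypotheses (mE : is_mean L E) (h0 : 0 <= h) (E_id : E id = 0).

Definition dissip_cst p : R := inelasticity a * 2 `^ (- p).

Lemma dissip_cst_gt0 p : 0 < dissip_cst p.
Proof. by rewrite mulr_gt0 ?powR_gt0// inelasticity_gt0. Qed.

(** Clarkson's inequality turns the gain into a moment of [x - y] of order
    [gamma + p], which centring compares with the moment of [x], and Jensen with
    a power of the moment of order [p]. *)
Lemma euler_step_absp p : 2 <= p ->
  step h E (absp p) <= E (absp p) * (1 - h * (dissip_cst p * E (absp p) `^ (gamma / p))).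
Proof.
move=> p2; have g0 := hgamma.
have p0 : 0 < p by lra.
have M0 : 0 <= E (absp p) by apply: (mean_ge0 mE) => x _; exact: powR_ge0.
have gp : 1 <= gamma + p by lra.
have jen : E (absp p) * E (absp p) `^ (gamma / p) <= E (absp (gamma + p)).
  have s1 : 1 <= (gamma + p) / p by rewrite ler_pdivlMr//; lra.
  have := mean_jensen mE s1 (fun x => powR_ge0 `|x| p).
  rewrite (mean_ext mE (f := fun x => (`|x| `^ p) `^ _) (g := absp (gamma + p))); last first.
    by move=> x _ /=; rewrite -powRrM; congr (_ `^ _); field; rewrite gt_eqF.
  rewrite (_ : (gamma + p) / p = gamma / p + 1); last by field; rewrite gt_eqF.
  have gp0 : 0 < gamma / p by rewrite divr_gt0.
  rewrite powRD; last by rewrite gt_eqF// ltr_wpDr.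
  by rewrite powRr1// mulrC.
have dis : mean2 E (rate_gain a gamma (absp p)) <=
    - (2 * dissip_cst p) * mean2 E (fun x y => `|x - y| `^ (gamma + p)).
  rewrite -(mean2Z mE); apply: (mean2_le mE) => x y _ _.
  have := gain_normr_powR ha x y p2.
  rewrite powRM// -[2^-1]powR_inv1// -powRrM mulN1r.
  move/(ler_wpM2l (powR_ge0 `|x - y| gamma)); rewrite /rate_gain; move/le_trans; apply.
  rewrite powRD; last by rewrite gt_eqF//; lra.
  rewrite /dissip_cst le_eqVlt; apply/orP; left; apply/eqP; ring.
have low : E (absp (gamma + p)) <= mean2 E (fun x y => `|x - y| `^ (gamma + p)).
  by apply: (mean_le mE) => x _; apply: (mean_normB_ge mE).
have c0 := dissip_cst_gt0 p.
pose X := mean2 E (fun x y => `|x - y| `^ (gamma + p)).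
have MX : E (absp p) * E (absp p) `^ (gamma / p) <= X := le_trans jen low.
rewrite -/X in dis.
rewrite /euler_step mulrBr mulr1 lerD2l.
apply: (@le_trans _ _ (h / 2 * (- (2 * dissip_cst p) * X))).
  by rewrite ler_wpM2l ?(divr_ge0 h0)//.
rewrite (_ : h / 2 * _ = - (h * dissip_cst p * X)); last by field.
rewrite lerN2 (_ : E _ * _ = h * dissip_cst p * (E (absp p) * E (absp p) `^ (gamma / p))); last by ring.
by rewrite ler_wpM2l// mulr_ge0// ltW.
Qed.

Lemma euler_step_normr :
  E Num.norm * (1 - h * (2 * 2 `^ gamma * E (absp gamma))) <= step h E Num.norm.
Proof.
rewrite mulrBr mulr1 /euler_step lerD2l.
have := mean2_le mE (fun x y _ _ => rate_gain_normr a x y (ltW hgamma)).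
rewrite -/(rate_gain a gamma Num.norm) => H.
have {H} : - (4 * 2 `^ gamma * (E (absp gamma) * E Num.norm)) <= mean2 E (rate_gain a gamma Num.norm).
  apply: le_trans H.
  rewrite (mean2N mE) (mean2Z mE) (mean2D mE) (mean2M mE).
  rewrite (mean2_ext mE (psi := fun x y => `|y| `^ gamma * `|x|) (psi' := fun x y => `|x| * `|y| `^ gamma)).
    rewrite (mean2M mE); lra.
  by move=> x y _ _; rewrite mulrC.
have h2 : 0 <= h / 2 by rewrite divr_ge0.
move=> /(ler_wpM2l h2); lra.
Qed.

End one_step.

Definition decay_cst p B : R := Num.max (B `^ (gamma / p)) (p / (gamma * dissip_cst p)).

Lemma decay_cst_gt0 p B : 0 < p -> 0 < decay_cst p B.
Proof.
move=> p0; rewrite lt_max; apply/orP; right.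
by rewrite divr_gt0// mulr_gt0// dissip_cst_gt0.
Qed.

Section iteration.
Variables (L h : R) (E0 : (R -> R) -> R).
Hypotheses (mE0 : is_mean L E0) (h0 : 0 <= h) (hL : h * (2 * L) `^ gamma <= 1).
Hypothesis (E0_id : E0 id = 0).

Local Notation E := (euler a gamma h E0).
Let mE k : is_mean L (E k) := euler_mean ha hgamma mE0 h0 hL k.
Let E_id k : E k id = 0.
Proof. by rewrite (euler_id ha hgamma mE0). Qed.

(** With [z = M_p^(gamma/p)] one step reads [z' <= z exp(- r z h)], a discrete
    form of [z' = - r z^2], whose solutions are below [1 / (r t)]. *)
Lemma euler_absp_decay p B k : 2 <= p -> E0 (absp p) <= B ->
  E k (absp p) <= (decay_cst p B / (1 + k%:R * h)) `^ (p / gamma).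
Proof.
move=> p2 hB; have g0 := hgamma; have h_ge0 := h0.
have p0 : 0 < p by lra.
have gp0 : 0 < gamma / p by rewrite divr_gt0.
pose M j := E j (absp p); pose z j := M j `^ (gamma / p).
have M0 j : 0 <= M j by apply: (mean_ge0 (mE j)) => x _; exact: powR_ge0.
have z0 j : 0 <= z j by exact: powR_ge0.
set D := decay_cst p B.
have D0 : 0 < D by exact: decay_cst_gt0.
have c0 := dissip_cst_gt0 p.
set c := gamma / p * dissip_cst p.
have c_gt0 : 0 < c by rewrite mulr_gt0.
have cD : 1 <= c * D.
  rewrite (_ : 1 = c * (p / (gamma * dissip_cst p))); last first.
    by rewrite /c; field; rewrite !gt_eqF.
  by rewrite ler_wpM2l ?(ltW c_gt0)// /D /decay_cst le_max lexx orbT.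
have stp j : z j.+1 * (1 + c * h * z j) <= z j.
  have H : M j.+1 <= M j * expR (- (h * (dissip_cst p * z j))).
    apply: le_trans (euler_step_absp (mE j) h0 (E_id j) p2) _.
    by apply: ler_wpM2l; [exact: M0|exact: expR_ge1Dx].
  have {}H : z j.+1 <= z j * expR (- (c * h * z j)).
    apply: (le_trans (ler_powR_base (ltW gp0) (M0 _) H)).
    rewrite powRM ?expR_ge0 ?M0//; apply: ler_wpM2l; first exact: z0.
    by rewrite -expRM ler_expR /c; lra.
  have w0 : 0 <= c * h * z j.
    by apply: mulr_ge0; [apply: mulr_ge0 => //; exact: ltW|exact: z0].
  have := ler_wpM2l (z0 j.+1) (expR_ge1Dx (c * h * z j)); move/le_trans; apply.
  apply: (le_trans (ler_wpM2r (expR_ge0 _) H)).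
  by rewrite -[leLHS]mulrA -expRD addNr expR0 mulr1.
have key j : z j * (1 + j%:R * h) <= D.
  elim: j => [|j IH].
    rewrite mul0r addr0 mulr1 /D /decay_cst le_max; apply/orP; left.
    by apply: ler_powR_base => //; exact: ltW.
  set T := 1 + j%:R * h in IH *.
  rewrite (_ : 1 + j.+1%:R * h = T + h); last by rewrite /T -addn1 natrD; ring.
  have w0 : 0 <= c * h * z j.
    by apply: mulr_ge0; [apply: mulr_ge0 => //; exact: ltW|exact: z0].
  have w1 : 0 < 1 + c * h * z j by lra.
  have T0 : 0 <= T + h by rewrite /T; have := mulr_ge0 (ler0n R j) h0; lra.
  rewrite -(ler_pM2r w1); have := ler_wpM2r T0 (stp j).
  have : z j * h <= (c * D) * (z j * h) by rewrite ler_peMl// mulr_ge0.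
  lra.
have T0 : 0 < 1 + k%:R * h by have := mulr_ge0 (ler0n R k) h0; lra.
have : z k <= D / (1 + k%:R * h) by rewrite ler_pdivlMr.
have pg0 : 0 <= p / gamma by rewrite divr_ge0// ltW.
move/(ler_powR_base pg0 (z0 k)); rewrite -powRrM.
rewrite (_ : gamma / p * (p / gamma) = 1) ?powRr1//.
by field; rewrite !gt_eqF.
Qed.

End iteration.

(** In the variable [x (1 + t)^(1/gamma)] and the time [log (1 + t)], the
    moments of order at least two stay bounded, and the first one, [v],
    satisfies [v' >= v (1/gamma - K m)] with [m] the moment of order [gamma].
    Interpolation bounds [m] by an arbitrarily small constant plus a multiple of
    [v], so that a small [v] has to grow. The pair consists of the lower bound
    and of the largest admissible time step. *)
Lemma euler_normr_lower B m : 0 < m -> exists2 ch : R * R, 0 < ch.1 /\ 0 < ch.2 &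
  forall L h E0, is_mean L E0 -> 0 <= h -> h * (2 * L) `^ gamma <= 1 -> h <= ch.2 ->
  E0 id = 0 -> E0 (absp (gamma + 2)) <= B -> m <= E0 Num.norm ->
  forall k, ch.1 <= euler a gamma h E0 k Num.norm * (1 + k%:R * h) `^ gamma^-1.
Proof.
move=> m0; have g0 := hgamma.
set q := gamma + 2.
have q2 : 2 <= q by rewrite /q; lra.
set D := decay_cst q B.
have D0 : 0 < D by apply: decay_cst_gt0; lra.
pose K : R := 2 * 2 `^ gamma; pose Q := D `^ (q / gamma).
have K0 : 0 < K by rewrite mulr_gt0// powR_gt0.
have Q0 : 0 <= Q by exact: powR_ge0.
pose r : R := Num.min 2^-1 (4 * gamma)^-1.
have r0 : 0 < r by rewrite lt_min !invr_gt0 mulr_gt0// andbT.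
have r1 : r <= 2^-1 by rewrite ge_min lexx.
have rg : r * (4 * gamma) <= 1.
  by rewrite -ler_pdivlMr ?mulr_gt0// mul1r ge_min lexx orbT.
pose eta := r / (2 * K * (1 + Q)).
have Q1 : 0 < 1 + Q by lra.
have eta0 : 0 < eta by rewrite divr_gt0// !mulr_gt0.
have [C C0 HC] := powR_interpolation g0 eta0.
pose c := Num.min m (r / (4 * K * C)).
have c0 : 0 < c by rewrite lt_min m0 divr_gt0// !mulr_gt0.
pose h1 := Num.min 1 (2 * K * D)^-1.
have h10 : 0 < h1 by rewrite lt_min ltr01 invr_gt0 !mulr_gt0.
exists (c, h1); first by split.
move=> L h E0 mE0 h0 hL /= hh E0id hB hm.
have hh1 : h <= 1 by rewrite (le_trans hh)// ge_min lexx.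
have hKD : h * (K * D) <= 2^-1.
  have : h <= (2 * K * D)^-1 by rewrite (le_trans hh)// ge_min lexx orbT.
  rewrite -[X in _ <= X]mul1r ler_pdivlMr ?mulr_gt0//; lra.
have mE k := euler_mean ha hgamma mE0 h0 hL k.
elim=> [|k IH].
  by rewrite mul0r addr0 powR1 mulr1 (le_trans _ hm)// ge_min lexx.
set T := 1 + k%:R * h in IH *.
have T1 : 1 <= T by rewrite /T lerDl mulr_ge0.
have T0 : 0 < T by lra.
have -> : 1 + k.+1%:R * h = T * (1 + h / T).
  by rewrite /T -addn1 natrD; field; rewrite gt_eqF.
set F := euler a gamma h E0 k in IH *.
have mF : is_mean L F := mE k.
set mu1 := F Num.norm in IH *.
have mu0 : 0 <= mu1 by apply: (mean_ge0 mF).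
have mq : F (absp q) <= (D / T) `^ (q / gamma).
  exact: (euler_absp_decay mE0 h0 hL E0id k q2 hB).
have gi0 : 0 <= gamma^-1 by rewrite invr_ge0 ltW.
have Tg : (T `^ gamma^-1) `^ gamma = T.
  by rewrite -powRrM mulVf ?gt_eqF// powRr1// ltW//.
have mg_crude : F (absp gamma) <= D / T.
  have s1 : 1 <= q / gamma by rewrite ler_pdivlMr//; rewrite /q; lra.
  have := mean_jensen mF s1 (fun x => powR_ge0 `|x| gamma).
  rewrite (mean_ext mF (f := fun x => (`|x| `^ gamma) `^ _) (g := absp q)); last first.
    by move=> x _ /=; rewrite -powRrM; congr (_ `^ _); field; rewrite gt_eqF.
  move/le_trans => /(_ _ mq).
  have gq0 : 0 <= gamma / q by rewrite divr_ge0// ltW//; lra.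
  move/(ler_powR_base gq0 (powR_ge0 _ _)); rewrite -!powRrM.
  have qn : q != 0 by rewrite gt_eqF//; lra.
  rewrite (_ : q / gamma * (gamma / q) = 1); last by field; rewrite qn gt_eqF.
  rewrite !powRr1//; first by rewrite divr_ge0// ltW.
  by apply: (mean_ge0 mF) => x _; exact: powR_ge0.
have mg_fine : F (absp gamma) <= (eta * (1 + Q) + C * (mu1 * T `^ gamma^-1)) / T.
  rewrite ler_pdivlMr//.
  rewrite mulrC -(meanZ mF).
  apply: (@le_trans _ _ (F (fun x => (eta * (1 + T `^ (q / gamma) * `|x| `^ q)) + C * T `^ gamma^-1 * `|x|))).
    apply: (mean_le mF) => x _.
    have := HC (T `^ gamma^-1 * `|x|) (mulr_ge0 (powR_ge0 _ _) (normr_ge0 _)).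
    rewrite !powRM ?powR_ge0// Tg -powRrM [gamma^-1 * _]mulrC -/q; lra.
  rewrite (meanD mF) !(meanZ mF) (meanD mF) (mean_cst mF) (meanZ mF).
  apply: lerD; last by rewrite -/mu1; lra.
  rewrite ler_wpM2l ?(ltW eta0)// lerD2l.
  apply: le_trans (ler_wpM2l (powR_ge0 _ _) mq) _.
  rewrite -powRM ?(ltW T0) ?(divr_ge0 (ltW D0) (ltW T0))//.
  by rewrite mulrC divfK ?gt_eqF.
have st : mu1 * (1 - h * (K * F (absp gamma))) <= step h F Num.norm.
  exact: (euler_step_normr mF h0).
have tau01 : 0 <= h / T <= 1.
  by rewrite divr_ge0 ?(ltW T0)//= ler_pdivrMr// mul1r (le_trans hh1).
rewrite powRM ?(ltW T0)//; last by case/andP: tau01 => ? _; lra.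
set v := mu1 * T `^ gamma^-1 in IH mg_fine.
set G := (1 + h / T) `^ gamma^-1.
have G1 : 1 <= G.
  by rewrite -(powRr0 (1 + h / T)) ler_powR//; case/andP: tau01; lra.
have Tp : 0 <= T `^ gamma^-1 by exact: powR_ge0.
have v0 : 0 <= v by rewrite mulr_ge0.
have fin : v * ((1 - h * (K * F (absp gamma))) * G) <= step h F Num.norm * (T `^ gamma^-1 * G).
  have := ler_wpM2r (mulr_ge0 Tp (le_trans ler01 G1)) st; rewrite /v; lra.
apply: le_trans fin.
have [v2c|v2c] := leP v (2 * c).
  (* the small regime: the growth of the scaling factor wins *)
  have KF : K * F (absp gamma) <= r / T.
    apply: (le_trans (ler_wpM2l (ltW K0) mg_fine)).
    rewrite mulrA ler_wpM2r ?invr_ge0 ?(ltW T0)//.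
    have cK : c * (4 * K * C) <= r.
      by rewrite -ler_pdivlMr ?mulr_gt0// ge_min lexx orbT.
    have eK : K * (eta * (1 + Q)) = r / 2.
      by rewrite /eta; field; rewrite !gt_eqF.
    have : K * (C * v) <= K * (C * (2 * c)) by rewrite !ler_wpM2l ?(ltW K0) ?(ltW C0).
    rewrite mulrDr eK; lra.
  apply: (le_trans IH); rewrite ler_peMr//.
  apply: (le_trans (decay_vs_growth g0 (ltW r0) r1 rg tau01)).
  rewrite ler_wpM2r ?(le_trans ler01 G1)// lerD2l lerN2.
  rewrite (_ : r * (h / T) = h * (r / T)); last by ring.
  by rewrite ler_wpM2l.
(* the large regime: a single step loses at most half of [v] *)
have step_ge : 2^-1 <= 1 - h * (K * F (absp gamma)).
  have : h * (K * F (absp gamma)) <= h * (K * D).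
    apply: ler_wpM2l => //; apply: ler_wpM2l; first exact: ltW.
    by rewrite (le_trans mg_crude)// ler_pdivrMr// ler_peMr// ltW.
  lra.
have : 2^-1 <= (1 - h * (K * F (absp gamma))) * G.
  apply: (le_trans step_ge); rewrite ler_peMr//.
  by rewrite (le_trans _ step_ge)// invr_ge0.
move/(ler_wpM2l v0); lra.
Qed.

End cooling.

(** * Limits along an ultrafilter *)

Lemma cvg_ler {R : realType} {T : Type} {F : set_system T} {FF : ProperFilter F}
    (u v : T -> R) (l l' : R) :
  u n @[n --> F] --> l -> v n @[n --> F] --> l' -> (forall n, u n <= v n) -> l <= l'.
Proof.
move=> ul vl uv; rewrite -subr_ge0.
have h : (fun n => v n - u n) @ F --> l' - l by exact: cvgB.
by apply: (cvgr_to_ge h); apply: nearW => n; rewrite subr_ge0.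
Qed.

Section ultralimit.
Context {R : realType} (U : set_system nat).
Hypothesis UU : UltraFilter U.
Implicit Types (u v : nat -> R).

(** An ultrafilter replaces the extraction of subsequences: the limits exist at
    once for all bounded sequences, so for all times and all test functions. *)
Lemma ultra_bounded_cvg u (M : R) : (\forall n \near U, `|u n| <= M) ->
  exists2 l, `|l| <= M & u n @[n --> U] --> l.
Proof.
move=> uM; pose F : set_system R := u @ U.
have FU : ProperFilter F by exact: fmap_proper_filter.
have := @segment_compact R (- M) M F FU.
have FI : F `[- M, M]%classic.
  by apply: filterS uM => n; rewrite ler_norml /= in_itv.
move=> /(_ FI)[l [lM cl]]; exists l; first by rewrite ler_norml; move: lM; rewrite /= in_itv.
move=> B /= lB.
have [//|nB] := in_ultra_setVsetC (u @^-1` B) UU.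
have [y []] := cl (~` B) B nB lB; by [].
Qed.

End ultralimit.

(** * Probabilities on the line from distribution functions *)
Section distribution_function.
Context {R : realType} (F : R -> R).
Hypotheses (F_nd : nondecreasing F) (F_rc : right_continuous F)
  (F_Ny : F @ -oo --> (0 : R)) (F_y : F @ +oo --> (1 : R)).

#[local] HB.instance Definition _ := isCumulative.Build R _ R F F_nd F_rc.
#[local] HB.instance Definition _ := isCumulativeBounded.Build R 0 1 F F_Ny F_y.

Lemma probability_of_cdf : exists P : probability (measurableTypeR R) R,
  forall x y, x <= y -> P `]x, y]%classic = (F y - F x)%:E.
Proof.
exists (lebesgue_stieltjes_measure F : probability _ _) => x y xy.
rewrite /= /lebesgue_stieltjes_measure /measure_extension/=.
rewrite measurable_mu_extE/=; last exact: is_ocitv.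
by rewrite wlength_itv_bnd.
Qed.

End distribution_function.

(** * Step functions on a grid *)
Section step_functions.
Context {R : realType}.
Implicit Types (x y t e : R) (xg : nat -> R).

Definition below t x : R := (x <= t)%R%:R.

Lemma below_nd t t' x : t <= t' -> below t x <= below t' x.
Proof.
by rewrite /below ler_nat => tt'; case: (leP x t) => //= xt; rewrite (le_trans xt tt').
Qed.

Lemma below01 t x : 0 <= below t x <= 1.
Proof. by rewrite /below ler0n; case: (x <= t)%R; rewrite /= ?lexx ?ler01. Qed.

Definition bump xg e i x : R := below (xg i.+1 + e) x - below (xg i + e) x.

Definition step2 (psi : R -> R -> R) xg e N x y : R :=
  \sum_(i < N) \sum_(j < N) psi (xg i) (xg j) * (bump xg e i x * bump xg e j y).

(** The weights [bump i x * bump j y] sum to [1] when both points lie in the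
    range of the grid, and then only the cell of [(x, y)] counts. *)
Lemma step2_error (psi : R -> R -> R) (M eta : R) N xg e x y :
  `|psi x y| <= M -> 0 <= eta -> (forall i, xg i <= xg i.+1) ->
  (forall i j, (i < N)%N -> (j < N)%N -> xg i + e < x <= xg i.+1 + e ->
     xg j + e < y <= xg j.+1 + e -> `|psi x y - psi (xg i) (xg j)| <= eta) ->
  `|psi x y - step2 psi xg e N x y| <=
    M * ((1 - (below (xg N + e) x - below (xg 0%N + e) x)) +
         (1 - (below (xg N + e) y - below (xg 0%N + e) y))) + eta.
Proof.
move=> psiM eta0 xg_nd close.
have b0 i z : 0 <= bump xg e i z.
  by rewrite subr_ge0; apply: below_nd; rewrite lerD2r.
have b_in i z : bump xg e i z != 0 -> xg i + e < z <= xg i.+1 + e.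
  rewrite /bump /below; case: (leP z (xg i + e)) => [zi|iz] /=.
    by rewrite (le_trans zi) ?lerD2r// subrr eqxx.
  by case: (z <= _) => //; rewrite subrr eqxx.
pose D z := below (xg N + e) z - below (xg 0%N + e) z.
have DE z : D z = \sum_(i < N) bump xg e i z.
  by rewrite -(big_mkord xpredT (fun i => bump xg e i z)) (telescope_sumr (fun i => below (xg i + e) z)).
have D01 z : 0 <= D z <= 1.
  rewrite {1}DE sumr_ge0//= /D.
  by have := below01 (xg N + e) z; have := below01 (xg 0%N + e) z; lra.
rewrite -/(D x) -/(D y).
have DD : D x * D y = \sum_(i < N) \sum_(j < N) bump xg e i x * bump xg e j y.
  by rewrite !DE big_distrlr.
rewrite (_ : _ - _ = psi x y * (1 - D x * D y) +
    \sum_(i < N) \sum_(j < N) (psi x y - psi (xg i) (xg j)) * (bump xg e i x * bump xg e j y)); last first.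
  rewrite mulrBr mulr1 DD -addrA; congr (_ + _).
  rewrite big_distrr -sumrN -sumrN -big_split /=; apply: eq_bigr => i _.
  rewrite big_distrr -sumrN -sumrN -big_split /=; apply: eq_bigr => j _; ring.
have [/andP[x0 x1] /andP[y0 y1]] := (D01 x, D01 y).
have xy : 0 <= (1 - D x) * (1 - D y) by rewrite mulr_ge0// subr_ge0.
have xy0 : 0 <= D x * D y by rewrite mulr_ge0.
apply: le_trans (ler_normD _ _) (lerD _ _).
  have h : 0 <= 1 - D x * D y by nra.
  rewrite normrM (ger0_norm h); apply: (le_trans (ler_wpM2r h psiM)).
  by rewrite ler_wpM2l ?(le_trans (normr_ge0 _) psiM)//; lra.
apply: (@le_trans _ _ (eta * (D x * D y))); last first.
  by rewrite -[leRHS]mulr1 ler_wpM2l//; nra.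
rewrite DD big_distrr /=; apply: (le_trans (ler_norm_sum _ _ _)).
apply: ler_sum => i _; rewrite big_distrr /=; apply: (le_trans (ler_norm_sum _ _ _)).
apply: ler_sum => j _; rewrite normrM (ger0_norm (mulr_ge0 (b0 i x) (b0 j y))).
have [->|ix] := eqVneq (bump xg e i x) 0; first by rewrite mul0r !mulr0.
have [->|jy] := eqVneq (bump xg e j y) 0; first by rewrite mulr0 !mulr0.
by rewrite ler_wpM2r ?mulr_ge0//; apply: close => //; exact: b_in.
Qed.

Lemma cell_close (t z dx e K del : R) : 0 <= e -> e <= 1 -> e <= del / 2 ->
  dx <= del / 2 -> - K <= t -> t + dx <= K -> t + e < z <= t + dx + e ->
  `|z| <= K + 1 /\ `|z - t| <= del.
Proof.
move=> e0 e1 ed dxd tK dxK /andP[z1 z2]; rewrite !ler_norml.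
by split; apply/andP; split; lra.
Qed.

Lemma mean2_step2 (L : R) (E : (R -> R) -> R) psi xg e N : is_mean L E ->
  mean2 E (step2 psi xg e N) =
  \sum_(i < N) \sum_(j < N) psi (xg i) (xg j) *
    ((E (below (xg i.+1 + e)) - E (below (xg i + e))) *
     (E (below (xg j.+1 + e)) - E (below (xg j + e)))).
Proof.
move=> mE.
rewrite [LHS](mean_ext mE (g := fun x => \sum_(i < N) \sum_(j < N)
   E (fun y => psi (xg i) (xg j) * (bump xg e i x * bump xg e j y)))); last first.
  move=> x _; rewrite (mean_sum mE); apply: eq_bigr => i _.
  by rewrite (mean_sum mE).
rewrite (mean_sum mE); apply: eq_bigr => i _.
rewrite (mean_sum mE); apply: eq_bigr => j _.
rewrite -[LHS]/(mean2 E (fun x y => psi (xg i) (xg j) * (bump xg e i x * bump xg e j y))).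
by rewrite (mean2Z mE) (mean2M mE) !(meanB mE).
Qed.

(** Heine's theorem on a box, with only the first point confined to it: the
    grid of the step functions may stick out of the box. *)
Lemma unif_continuous_box (psi : R * R -> R) (K eta : R) :
  continuous psi -> 0 < eta -> exists2 del : R, 0 < del &
  forall x y x' y', `|x| <= K -> `|y| <= K -> `|x - x'| <= del -> `|y - y'| <= del ->
    `|psi (x, y) - psi (x', y')| <= eta.
Proof.
move=> cpsi eta0.
have cK : compact (`[- K, K]%classic `*` `[- K, K]%classic : set (R * R)).
  by apply: compact_setX; exact: segment_compact.
have /compact_near_coveringP nc := cK.
pose Pr (del : R) (z : R * R) := forall z' : R * R,
  `|z.1 - z'.1| <= del -> `|z.2 - z'.2| <= del -> `|psi z - psi z'| <= eta.
have := @nc R (0^'+) Pr _.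
case=> [z _|d /= d0 dP].
  have e2 : 0 < eta / 2 by rewrite divr_gt0.
  have /cvgrPdist_le/(_ _ e2) := cpsi z.
  move=> /nbhs_ballP[r /= r0 rP].
  exists ([set z' | ball z (r / 2) z'], [set del | 0 < del < r / 2]).
    split => /=; first by apply/nbhs_ballP; exists (r / 2) => //=; rewrite divr_gt0.
    exists (r / 2) => /=; first by rewrite divr_gt0.
    move=> t /=; rewrite sub0r normrN => tr t0; rewrite t0 /=.
    by rewrite (le_lt_trans _ tr)// ler_norm.
  move=> [w del] /= [[w1 w2] /andP[del0 delr]] z' z1 z2.
  have zw : `|psi z - psi w| <= eta / 2.
    apply: rP; split; [apply: lt_trans w1 _|apply: lt_trans w2 _];
      by rewrite ltr_pdivrMr// ltr_pMr// ltr1n.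
  have zz' : `|psi z - psi z'| <= eta / 2.
    apply: rP; split => /=.
      have := ler_distD w.1 z.1 z'.1; move: w1; rewrite /ball/= => *; lra.
    have := ler_distD w.2 z.2 z'.2; move: w2; rewrite /ball/= => *; lra.
  have := ler_distD (psi z) (psi w) (psi z'); rewrite [`|psi w - psi z|]distrC; lra.
exists (d / 2); first by rewrite divr_gt0.
move=> x y x' y' xK yK xx yy.
have := dP (d / 2); rewrite /= sub0r normrN gtr0_norm ?divr_gt0//.
rewrite ltr_pdivrMr// ltr_pMr// ltr1n => /(_ isT isT (x, y)).
apply => //=; split; by rewrite /= in_itv /= -ler_norml.
Qed.

End step_functions.

(** * Integrals of step functions *)
Section bounded_integrals.
Context d (T : measurableType d) {R : realType} (mu : {measure set T -> \bar R}).
Hypothesis mu1 : mu setT = 1%E.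
Implicit Types (f g : T -> R) (M : R).

Lemma bounded_integrable f M : measurable_fun setT f -> (forall z, `|f z| <= M) ->
  mu.-integrable setT (EFin \o f).
Proof.
move=> mf fM; apply: measurable_bounded_integrable => //; first by rewrite mu1 ltry.
exists M; split; first exact: num_real.
by move=> y My z _ /=; apply: le_trans (fM z) (ltW My).
Qed.

Lemma Rintegral_sum (I : Type) (s : seq I) (F : I -> T -> R) :
  (forall i, mu.-integrable setT (EFin \o F i)) ->
  mu.-integrable setT (EFin \o (fun z => \sum_(i <- s) F i z)) /\
  \int[mu]_z (\sum_(i <- s) F i z) = \sum_(i <- s) \int[mu]_z F i z.
Proof.
move=> Fi; elim: s => [|i s [IHi IH]].
  split.
    apply: (@bounded_integrable _ 0); last by move=> z; rewrite big_nil normr0.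
    by under eq_fun do rewrite big_nil; exact: measurable_cst.
  rewrite big_nil; under eq_Rintegral do rewrite big_nil.
  by rewrite Rintegral_cst// mul0r.
have e : (fun z => \sum_(j <- i :: s) F j z) = (fun z => F i z + \sum_(j <- s) F j z).
  by apply/funext => z; rewrite big_cons.
split.
  rewrite e (_ : EFin \o _ = (EFin \o F i) \+ (EFin \o (fun z => (\sum_(j <- s) F j z)%R)))%E//.
  exact: integrableD.
by rewrite e RintegralD// IH big_cons.
Qed.

Lemma Rintegral_indicator (A : set T) : measurable A ->
  \int[mu]_z (\1_A z : R) = fine (mu A).
Proof. by move=> mA; rewrite /Rintegral integral_indic// setIT. Qed.

End bounded_integrals.

Lemma cvg_sumr {R : realType} (T : Type) (F : set_system T) (I : Type) (s : seq I)
    (f : I -> T -> R) (l : I -> R) : Filter F ->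
  (forall i, f i n @[n --> F] --> l i) ->
  \sum_(i <- s) f i n @[n --> F] --> \sum_(i <- s) l i.
Proof.
move=> FF fl; elim: s => [|i s IH].
  by rewrite big_nil; under eq_fun do rewrite big_nil; exact: cvg_cst.
by rewrite big_cons; under eq_fun do rewrite big_cons; apply: cvgD.
Qed.

Section step_integrals.
Context {R : realType} (P : probability (measurableTypeR R) R) (F : R -> R).
Hypothesis PF : forall x y, x <= y -> P `]x, y]%classic = (F y - F x)%:E.
Local Notation rR := (measurableTypeR R).

Lemma product_probability_setT : (P \x P)%E setT = 1%E.
Proof.
rewrite -setXTT product_measure1E// -[RHS]mule1.
by congr (_ * _)%E; exact: probability_setT.
Qed.
Let PP1 := product_probability_setT.

Variables (psi : R -> R -> R) (xg : nat -> R) (N : nat).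
Hypothesis xg_nd : forall i, xg i <= xg i.+1.

Let cell i : set rR := `]xg i, xg i.+1]%classic.

Let mcell i : measurable (cell i).
Proof. exact: measurable_itv. Qed.

Let bumpE i (z : R) : bump xg 0 i z = \1_(cell i) z.
Proof.
rewrite /bump /below !addr0 indicE /cell.
have [zi|iz] := leP z (xg i).
  rewrite (le_trans zi)// subrr memNset//= in_itv/=.
  by rewrite ltNge zi.
have [zi|iz'] := leP z (xg i.+1).
  by rewrite subr0 mem_set//= in_itv/= iz zi.
by rewrite subrr memNset//= in_itv/= iz/= leNgt iz'.
Qed.

Let term (i j : nat) (z : rR * rR) : R :=
  psi (xg i) (xg j) * \1_(cell i `*` cell j) z.

Let mterm i j : measurable (cell i `*` cell j).
Proof. by apply: measurableX; exact: mcell. Qed.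

Let iterm i j : (P \x P)%E.-integrable setT (EFin \o term i j).
Proof.
apply: (@bounded_integrable _ _ _ _ PP1 _ `|psi (xg i) (xg j)|).
  by apply: measurable_funM; [exact: measurable_cst|exact: measurable_indic].
move=> z; rewrite /term normrM indicE.
by case: (_ \in _); rewrite ?normr1 ?normr0 ?mulr1 ?mulr0.
Qed.

Let step2E (z : rR * rR) :
  step2 psi xg 0 N z.1 z.2 = \sum_(i < N) \sum_(j < N) term i j z.
Proof.
apply: eq_bigr => i _; apply: eq_bigr => j _.
by rewrite /term !bumpE !indicE in_setX -natrM mulnb.
Qed.

Lemma Rintegral_step2 :
  (P \x P)%E.-integrable setT (EFin \o (fun z : rR * rR => step2 psi xg 0 N z.1 z.2)) /\
  \int[(P \x P)%E]_z step2 psi xg 0 N z.1 z.2 =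
  \sum_(i < N) \sum_(j < N) psi (xg i) (xg j) *
    ((F (xg i.+1) - F (xg i)) * (F (xg j.+1) - F (xg j))).
Proof.
have sums := fun i : 'I_N => Rintegral_sum PP1 (index_enum 'I_N) (fun j : 'I_N => iterm i j).
have [int_sum sumE] := Rintegral_sum PP1 (index_enum 'I_N) (fun i => (sums i).1).
rewrite (_ : (fun z : rR * rR => step2 psi xg 0 N z.1 z.2) =
   (fun z => \sum_(i < N) \sum_(j < N) term i j z)); last exact/funext/step2E.
split => //; rewrite sumE; apply: eq_bigr => i _.
rewrite (sums i).2; apply: eq_bigr => j _.
rewrite /term RintegralZl//; last first.
  apply: (@bounded_integrable _ _ _ _ PP1 _ 1); first exact: measurable_indic.
  by move=> z; rewrite indicE; case: (_ \in _); rewrite ?normr1 ?normr0.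
rewrite Rintegral_indicator//; congr (_ * _).
have PE k : F (xg k.+1) - F (xg k) = fine (P (cell k)) by rewrite PF.
transitivity (fine ((P \x P)%E (cell i `*` cell j))) => //.
by rewrite product_measure1E// fineM ?fin_num_measure// !PE.
Qed.

End step_integrals.

Section law.
Context d (T : measurableType d) {R : realType} (mu : {measure set T -> \bar R}).
Context (X : T -> measurableTypeR R) (nu : {measure set (measurableTypeR R) -> \bar R}).
Hypotheses (mX : measurable_fun setT X)
  (lawX : forall A, measurable A -> mu (X @^-1` A) = nu A).
Implicit Type f : R -> R.

Lemma ge0_integral_law f : measurable_fun setT (f : measurableTypeR R -> R) ->
  (forall x, 0 <= f x) ->
  (\int[mu]_z (f (X z))%:E = \int[nu]_x (f x)%:E)%E.
Proof.
move=> mf f0.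
have := @ge0_integral_pushforward _ _ _ _ R X mX mu setT (EFin \o f) measurableT.
rewrite preimage_setT => <-.
- by apply: eq_measure_integral => B mB _; exact: lawX.
- exact/measurable_EFinP.
- by move=> x _; rewrite lee_fin.
Qed.

Lemma integrable_law f : measurable_fun setT (f : measurableTypeR R -> R) ->
  nu.-integrable setT (EFin \o f) <-> mu.-integrable setT (EFin \o (fun z => f (X z))).
Proof.
move=> mf.
have mfX : measurable_fun setT (fun z => f (X z)) by exact: measurableT_comp.
have mn : measurable_fun setT (fun x : measurableTypeR R => `|f x|).
  exact: measurableT_comp.
have e := ge0_integral_law mn (fun x => normr_ge0 _).
by split=> /integrableP[_ h]; apply/integrableP; split;
  [exact/measurable_EFinP|rewrite /= e|exact/measurable_EFinP|rewrite /= -e].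
Qed.

Lemma Rintegral_law f : measurable_fun setT (f : measurableTypeR R -> R) ->
  nu.-integrable setT (EFin \o f) -> \int[mu]_z f (X z) = \int[nu]_x f x.
Proof.
move=> mf /(integrable_law mf) h; rewrite /Rintegral; congr fine.
have := @integral_pushforward _ _ _ _ R X mX mu setT (EFin \o f).
rewrite preimage_setT => <- //; first by apply: eq_measure_integral => B mB _; exact: lawX.
exact/measurable_EFinP.
Qed.

End law.

Section product_marginals.
Context {R : realType} (P : probability (measurableTypeR R) R).
Local Notation rR := (measurableTypeR R).

Lemma law_fst (A : set rR) : measurable A -> (P \x P)%E (fst @^-1` A) = P A.
Proof.
move=> mA; rewrite (_ : fst @^-1` A = A `*` setT); last first.
  by apply/seteqP; split => -[x y] //= -[].
rewrite product_measure1E// -[RHS]mule1.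
by congr (_ * _)%E; exact: probability_setT.
Qed.

Lemma law_snd (A : set rR) : measurable A -> (P \x P)%E (snd @^-1` A) = P A.
Proof.
move=> mA; rewrite (_ : snd @^-1` A = setT `*` A); last first.
  by apply/seteqP; split => -[x y] //= -[].
rewrite product_measure1E// -[RHS]mul1e.
by congr (_ * _)%E; exact: probability_setT.
Qed.

End product_marginals.

Section step_error.
Context {R : realType} (P : probability (measurableTypeR R) R) (F : R -> R).
Hypothesis PF : forall x y, x <= y -> P `]x, y]%classic = (F y - F x)%:E.
Local Notation rR := (measurableTypeR R).
Variables (psi : R -> R -> R) (M eta : R) (xg : nat -> R) (N : nat).
Hypotheses (xg_nd : forall i, xg i <= xg i.+1)
  (mpsi : measurable_fun setT (fun z : rR * rR => psi z.1 z.2))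
  (psiM : forall x y, `|psi x y| <= M).

Let tail x : R := 1 - (below (xg N + 0) x - below (xg 0%N + 0) x).
Hypothesis err : forall x y,
  `|psi x y - step2 psi xg 0 N x y| <= M * (tail x + tail y) + eta.

Let lohi : xg 0%N <= xg N.
Proof. by elim: N => // n IH; exact: le_trans IH (xg_nd n). Qed.

Let tailE : tail = (fun x => 1 - \1_(`]xg 0%N, xg N]%classic : set rR) x).
Proof.
apply/funext => x; rewrite /tail !addr0 indicE /below; congr (1 - _).
have [x0|x0] := leP x (xg 0%N).
  rewrite (le_trans x0 lohi) subrr memNset//= in_itv/= ltNge.
  by rewrite x0.
rewrite subr0; congr ((nat_of_bool _)%:R).
by apply/idP/idP => [xt|]; rewrite ?inE /= in_itv/= x0.
Qed.

Let mtail : measurable_fun setT (tail : rR -> R).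
Proof.
rewrite tailE; apply: measurable_funB; first exact: measurable_cst.
exact: measurable_indic.
Qed.

Let tail01 x : 0 <= tail x <= 1.
Proof.
by rewrite tailE indicE; case: (_ \in _); rewrite ?subrr ?subr0 ?lexx ?ler01.
Qed.

Let itail : P.-integrable setT (EFin \o tail).
Proof.
apply: (@bounded_integrable _ _ _ P (probability_setT P) _ 1) => // x.
by have /andP[h0 h1] := tail01 x; rewrite ger0_norm.
Qed.

Let Etail : \int[P]_x tail x = 1 - (F (xg N) - F (xg 0%N)).
Proof.
have PE : fine (P `]xg 0%N, xg N]%classic) = F (xg N) - F (xg 0%N) by rewrite PF.
rewrite tailE RintegralB//; last 2 first.
- by apply: (@bounded_integrable _ _ _ P (probability_setT P) _ 1) => // z; rewrite normr1.
- apply: (@bounded_integrable _ _ _ P (probability_setT P) _ 1).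
    exact: measurable_indic.
  by move=> z; rewrite indicE; case: (_ \in _); rewrite ?normr1 ?normr0.
rewrite Rintegral_cst// mul1r Rintegral_indicator//; congr (_ - _) => //.
by rewrite -[RHS]/(fine 1%:E); congr fine; exact: probability_setT.
Qed.

Lemma Rintegral_step2_error :
  `|\int[(P \x P)%E]_z psi z.1 z.2 - \int[(P \x P)%E]_z step2 psi xg 0 N z.1 z.2| <=
  M * (2 * (1 - (F (xg N) - F (xg 0%N)))) + eta.
Proof.
set mu := (P \x P)%E.
have mu1 : mu setT = 1%E := product_probability_setT P.
have M0 : 0 <= M by apply: le_trans (psiM 0 0).
have ipsi : mu.-integrable setT (EFin \o (fun z => psi z.1 z.2)).
  exact: (@bounded_integrable _ _ _ _ mu1 _ M).
have istep := (Rintegral_step2 PF psi N xg_nd).1.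
have i1 := (integrable_law measurable_fst (law_fst P) mtail).1 itail.
have i2 := (integrable_law measurable_snd (law_snd P) mtail).1 itail.
have j1 := Rintegral_law measurable_fst (law_fst P) mtail itail.
have j2 := Rintegral_law measurable_snd (law_snd P) mtail itail.
have i12 : mu.-integrable setT (EFin \o (fun z => tail z.1 + tail z.2)).
  exact: (integrableD measurableT i1 i2).
have iM : mu.-integrable setT (EFin \o (fun z => M * (tail z.1 + tail z.2))).
  by apply: (integrableZl measurableT M i12).
have ieta : mu.-integrable setT (EFin \o (fun=> eta)).
  by apply: (@bounded_integrable _ _ _ _ mu1 _ `|eta|) => //; exact: measurable_cst.
have ierr : mu.-integrable setT (EFin \o (fun z => M * (tail z.1 + tail z.2) + eta)).
  exact: (integrableD measurableT iM ieta).
rewrite -RintegralB//.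
have iB : mu.-integrable setT (EFin \o (fun z => psi z.1 z.2 - step2 psi xg 0 N z.1 z.2)).
  exact: (integrableB measurableT ipsi istep).
apply: (le_trans (le_normr_Rintegral measurableT iB)).
apply: (@le_trans _ _ (\int[mu]_z (M * (tail z.1 + tail z.2) + eta))).
  by apply: le_Rintegral => //; exact: (integrable_norm iB).
rewrite (RintegralD measurableT iM ieta) (RintegralZl M measurableT i12).
rewrite (RintegralD measurableT i1 i2) j1 j2 Etail Rintegral_cst// lerD//.
  by rewrite ler_wpM2l//; lra.
by rewrite (_ : fine _ = fine 1%:E) ?mulr1//; congr fine; exact: mu1.
Qed.

End step_error.

(** * Helly's selection theorem *)
Section helly.
Context {R : realType} (U : set_system nat).
Hypothesis UU : UltraFilter U.
Variables (E : nat -> (R -> R) -> R) (L : nat -> R) (A : R).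
Hypotheses (mE : forall n, is_mean (L n) (E n)) (tight : forall n, E n (wt 1) <= A).

Let G x : R := lim (E n (below x) @[n --> U]).

Let EG x : E n (below x) @[n --> U] --> G x.
Proof.
have [l _ h] : exists2 l, `|l| <= 1 & E n (below x) @[n --> U] --> l.
  apply: ultra_bounded_cvg => //; apply: nearW => n.
  rewrite -[leRHS](mean1 (mE n)); apply: (mean_norm (mE n)) => y _.
  by have /andP[h0 h1] := below01 x y; rewrite ger0_norm.
by rewrite /G (cvg_lim _ h).
Qed.

Let G_nd x y : x <= y -> G x <= G y.
Proof.
move=> xy; apply: (cvg_ler (@EG x) (@EG y)) => n.
by apply: (mean_le (mE n)) => z _; exact: below_nd.
Qed.

Let G01 x : 0 <= G x <= 1.
Proof.
apply/andP; split.
  apply: (cvg_ler (cvg_cst (0 : R)) (@EG x)) => n.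
  by apply: (mean_ge0 (mE n)) => z _; case/andP: (below01 x z).
apply: (cvg_ler (@EG x) (cvg_cst (1 : R))) => n.
rewrite -[leRHS](mean1 (mE n)); apply: (mean_le (mE n)) => y _.
by case/andP: (below01 x y).
Qed.

(** Chebyshev's inequality, uniform along the sequence. *)
Let G_tail x : 0 < x -> 1 - A / x ^+ 2 <= G x /\ G (- x) <= A / x ^+ 2.
Proof.
move=> x0; have x20 : 0 < x ^+ 2 by rewrite exprn_gt0.
have bd n : E n (fun y => (x ^+ 2)^-1 * wt 1 y) <= A / x ^+ 2.
  by rewrite (meanZ (mE n)) mulrC ler_wpM2r// invr_ge0 ltW.
have wtE y : (x ^+ 2)^-1 * wt 1 y = (1 + y ^+ 2) / x ^+ 2.
  by rewrite /wt powRr1 1?mulrC// ltW// wtb_gt0.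
have w0 y : 0 <= (1 + y ^+ 2) / x ^+ 2.
  by rewrite divr_ge0// ltW// wtb_gt0.
split.
  apply: (cvg_ler (cvg_cst (1 - A / x ^+ 2)) (@EG x)) => n.
  rewrite lerBlDr -lerBlDl; apply: le_trans (bd n).
  rewrite -{1}(mean1 (mE n)) -(meanB (mE n)); apply: (mean_le (mE n)) => y _.
  rewrite wtE /below; case: (leP y x) => xy; first by rewrite subrr.
  rewrite subr0 ler_pdivlMr// mul1r.
  by rewrite ler_wpDl// lerXn2r ?nnegrE// ltW// (lt_trans x0).
apply: (cvg_ler (@EG (- x)) (cvg_cst (A / x ^+ 2))) => n.
apply: le_trans (bd n); apply: (mean_le (mE n)) => y _.
rewrite wtE /below; case: (leP y (- x)) => xy //.
rewrite ler_pdivlMr// mul1r -sqrrN -[y ^+ 2]sqrrN sqrrN.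
by rewrite ler_wpDl// lerXn2r ?nnegrE; lra.
Qed.

Let A_ge0 : 0 <= A.
Proof.
apply: le_trans (tight 0%N); apply: (mean_ge0 (mE 0%N)) => x _; exact: wt_ge0.
Qed.

Let G_lim eta : 0 < eta -> exists2 K : R, 1 <= K &
  forall x, K <= x -> 1 - eta <= G x /\ G (- x) <= eta.
Proof.
move=> e0; exists (1 + A / eta); first by rewrite lerDl divr_ge0// ltW.
move=> x Kx.
have Ae : 0 <= A / eta by rewrite divr_ge0// ltW.
have x1 : 1 <= x by lra.
have x0 : 0 < x by lra.
have [g1 g2] := G_tail x0.
have h : A / x ^+ 2 <= eta.
  rewrite ler_pdivrMr ?exprn_gt0// mulrC -ler_pdivrMr//.
  by rewrite (@le_trans _ _ x)//; [lra|rewrite expr2 ler_peMr// ltW].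
by split; [lra|exact: le_trans g2 h].
Qed.

Let F x : R := inf [set G y | y in [set` Interval (BRight x) +oo%O]].

Let hasF x : has_lbound [set G y | y in [set` Interval (BRight x) +oo%O]].
Proof. by exists 0 => _ [y _ <-]; case/andP: (G01 y). Qed.

Let G_right x : G y @[y --> x^'+] --> F x.
Proof.
apply: nondecreasing_at_right_cvgr => // y z _ _; exact: G_nd.
Qed.

Let GF x : G x <= F x.
Proof.
apply: lb_le_inf.
  by exists (G (x + 1)), (x + 1) => //=; rewrite in_itv/= andbT ltrDl.
by move=> _ [y + <-]; rewrite /= in_itv/= andbT => /ltW; exact: G_nd.
Qed.

Let FG x y : x < y -> F x <= G y.
Proof. by move=> xy; apply: ge_inf => //; exists y => //=; rewrite in_itv/= andbT. Qed.

Let F_nd : nondecreasing F.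
Proof.
move=> x y; rewrite le_eqVlt => /predU1P[->//|xy].
exact: le_trans (FG xy) (GF y).
Qed.

Let F_rc : right_continuous F.
Proof.
move=> x; apply/cvgrPdist_le => eta e0.
have /cvgrPdist_le/(_ _ e0)[d /= d0 dP] := @G_right x.
exists (d / 2) => /=; first by rewrite divr_gt0.
move=> y /= xyd xy.
have Fxy := F_nd (ltW xy).
rewrite distrC ger0_norm ?subr_ge0//.
pose z := 2 * y - x.
have yz : y < z by rewrite /z; lra.
have := FG yz; have := dP z.
rewrite distrC gtr0_norm in xyd; last by rewrite subr_gt0.
rewrite /= distrC gtr0_norm; last by rewrite /z; lra.
have zd : z - x < d by rewrite /z; lra.
move=> /(_ zd (lt_trans xy yz)); rewrite distrC ger0_norm; last first.
  by rewrite subr_ge0 FG// (lt_trans xy).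
lra.
Qed.

Let F_Ny : F @ -oo --> (0 : R).
Proof.
apply/cvgrPdist_le => eta e0; have [K K1 KP] := G_lim e0.
near=> x.
have F0 : 0 <= F x by apply: le_trans (GF x); case/andP: (G01 x).
rewrite sub0r normrN ger0_norm//.
have h : x < - K by near: x; apply: nbhs_ninfty_lt; exact: num_real.
by apply: le_trans (FG h) _; case: (KP K (lexx _)).
Unshelve. all: by end_near. Qed.

Let F_y : F @ +oo --> (1 : R).
Proof.
apply/cvgrPdist_le => eta e0; have [K K1 KP] := G_lim e0.
near=> x.
have F1 : F x <= 1.
  have xx : x < x + 1 by rewrite ltrDl.
  by apply: le_trans (FG xx) _; case/andP: (G01 (x + 1)).
rewrite ger0_norm ?subr_ge0//.
have h : K <= x by near: x; apply: nbhs_pinfty_ge; exact: num_real.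
by have [g _] := KP x h; have := GF x; lra.
Unshelve. all: by end_near. Qed.

Let GF_seq x : G (x + k.+1%:R^-1) @[k --> \oo] --> F x.
Proof.
have /cvg_at_rightP H := @G_right x.
apply: (H (fun k => x + k.+1%:R^-1)); split; first by move=> k; rewrite ltrDl.
rewrite -[X in _ --> X]addr0; apply: cvgD; first exact: cvg_cst.
exact: cvg_harmonic.
Qed.

(** The measure has the right-continuous version [F] of the limit distribution
    function [G]. Test functions are approximated by step functions on a grid.
    At a jump [F] and [G] may differ at a point of the grid; moving the grid to
    the right by [e], and letting [e] tend to zero after the limit along the
    ultrafilter, reconciles them. *)
Lemma helly_bounded : exists P : probability (measurableTypeR R) R,
  forall (psi : R -> R -> R) (M : R),
  continuous (fun z : R * R => psi z.1 z.2) ->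
  measurable_fun setT (fun z : measurableTypeR R * measurableTypeR R => psi z.1 z.2) ->
  (forall x y, `|psi x y| <= M) ->
  mean2 (E n) psi @[n --> U] --> \int[(P \x P)%E]_z psi z.1 z.2.
Proof.
have [P PF] := probability_of_cdf F_nd F_rc F_Ny F_y.
exists P => psi M cpsi mpsi psiM.
set mu := (P \x P)%E; set I := Rintegral _ _ _.
have mu1 : mu setT = 1%E := product_probability_setT P.
have M0 : 0 <= M by apply: le_trans (psiM 0 0).
have [l _ psil] : exists2 l, `|l| <= M & mean2 (E n) psi @[n --> U] --> l.
  apply: ultra_bounded_cvg => //; apply: nearW => n.
  rewrite -[leRHS](mean_cst (mE n)) -(mean2_fst (mE n)).
  by apply: (mean2_norm (mE n)) => x y _ _.
suff -> : I = l by [].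
suff key (eta : R) : 0 < eta -> `|l - I| <= 4 * eta.
  apply/eqP; rewrite eq_sym -subr_eq0 -normr_le0; apply/ler_addgt0Pr => e e0.
  by rewrite add0r (le_trans (key (e / 4) _)) ?divr_gt0// mulrC divfK.
move=> eta0.
have eta'0 : 0 < eta / (4 * M + 1) by rewrite divr_gt0//; lra.
have [K0 K01 KP] := G_lim eta'0.
pose K := K0 + 1.
have [del del0 delP] := @unif_continuous_box R _ (K + 1) eta cpsi eta0.
pose N := (Num.truncn (4 * K / del)).+1.
have N0 : 0 < N%:R :> R by rewrite ltr0n.
pose dx := 2 * K / N%:R.
have K_gt0 : 0 < K by rewrite /K; lra.
have dx0 : 0 < dx by rewrite divr_gt0// mulr_gt0.
have dxd : dx <= del / 2.
  have : 4 * K / del < N%:R by have /Num.Theory.truncn_itv/andP[] : 0 <= 4 * K / del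
    by rewrite divr_ge0 ?mulr_ge0// ltW.
  rewrite ltr_pdivrMr// /dx ler_pdivrMr//; lra.
pose xg (i : nat) := - K + i%:R * dx.
have xg_nd i : xg i <= xg i.+1.
  by rewrite lerD2l ler_pM2r// ler_nat.
have xgS i : xg i.+1 = xg i + dx by rewrite /xg -addn1 natrD; ring.
have xg0 : xg 0%N = - K by rewrite /xg mul0r addr0.
have xgN : xg N = K by rewrite /xg /dx mulrC divfK ?gt_eqF//; ring.
have xg_le i : (i <= N)%N -> - K <= xg i <= K.
  move=> iN; rewrite -xg0 -xgN /xg !lerD2l !ler_pM2r// !ler_nat.
  by rewrite leq0n iN.
pose tail x e : R := 1 - (below (xg N + e) x - below (xg 0%N + e) x).
have err e x y : 0 <= e -> e <= 1 -> e <= del / 2 ->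
    `|psi x y - step2 psi xg e N x y| <= M * (tail x e + tail y e) + eta.
  move=> e0 e1 ed; apply: step2_error => //; first exact: ltW.
  have cell i z : (i < N)%N -> xg i + e < z <= xg i.+1 + e ->
      `|z| <= K + 1 /\ `|z - xg i| <= del.
    move=> iN; rewrite xgS => iz.
    have /andP[i1 _] := xg_le i (ltnW iN); have /andP[_] := xg_le _ iN.
    by rewrite xgS => i2; exact: cell_close iz.
  move=> i j iN jN ix jy.
  have [x1 x2] := cell i x iN ix; have [y1 y2] := cell j y jN jy.
  exact: (delP x y (xg i) (xg j)).
have tailG : M * (2 * (1 - (G K - G (- K + 1)))) <= eta.
  have [h1 h2] := KP K ltac:(rewrite /K; lra).
  have [_ h3] := KP K0 (lexx _).
  rewrite (_ : - K + 1 = - K0); last by rewrite /K; ring.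
  have : eta / (4 * M + 1) * (4 * M + 1) = eta by rewrite divfK// gt_eqF//; lra.
  have : 0 <= M * (eta / (4 * M + 1)) by rewrite mulr_ge0// ltW.
  have : M * (2 * (1 - (G K - G (- K0)))) <= M * (4 * (eta / (4 * M + 1))).
    by rewrite ler_wpM2l//; lra.
  lra.
(* Masses of step functions, for the distribution function [H] and the shift [e]. *)
pose V (H : R -> R) e := \sum_(i < N) \sum_(j < N) psi (xg i) (xg j) *
    ((H (xg i.+1 + e) - H (xg i + e)) * (H (xg j.+1 + e) - H (xg j + e))).
have GV e : 0 <= e -> e <= 1 -> e <= del / 2 -> `|l - V G e| <= 2 * eta.
  move=> e0 e1 ed.
  have cs : mean2 (E n) (step2 psi xg e N) @[n --> U] --> V G e.
    under eq_fun do rewrite (mean2_step2 _ _ _ _ (mE _)).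
    apply: cvg_sumr => i; apply: cvg_sumr => j; apply: cvgM; first exact: cvg_cst.
    by apply: cvgM; apply: cvgB; exact: EG.
  have ct : M * (2 * (1 - (E n (below (xg N + e)) - E n (below (xg 0%N + e))))) + eta
      @[n --> U] --> M * (2 * (1 - (G (xg N + e) - G (xg 0%N + e)))) + eta.
    apply: cvgD; last exact: cvg_cst.
    apply: cvgM; first exact: cvg_cst.
    apply: cvgM; first exact: cvg_cst.
    apply: cvgB; first exact: cvg_cst.
    by apply: cvgB; exact: EG.
  have cl : `|mean2 (E n) psi - mean2 (E n) (step2 psi xg e N)| @[n --> U] --> `|l - V G e|.
    by apply: cvg_norm; exact: cvgB.
  apply: (@le_trans _ _ (M * (2 * (1 - (G (xg N + e) - G (xg 0%N + e)))) + eta)).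
    apply: (cvg_ler cl ct) => n.
    rewrite -(mean2B (mE n)).
    apply: (le_trans (mean2_norm (mE n) (fun x y _ _ => err e x y e0 e1 ed))).
    rewrite (mean2D (mE n)) (mean2Z (mE n)) (mean2D (mE n)).
    rewrite (mean2_fst (mE n)) (mean2_snd (mE n)) (mean2_fst (mE n) (fun=> eta)) (mean_cst (mE n)).
    rewrite /tail (meanB (mE n)) (meanB (mE n)) (mean1 (mE n)); lra.
  rewrite xgN xg0.
  have g1 : G K <= G (K + e) by apply: G_nd; lra.
  have g2 : G (- K + e) <= G (- K + 1) by apply: G_nd; lra.
  have : M * (2 * (1 - (G (K + e) - G (- K + e)))) <= M * (2 * (1 - (G K - G (- K + 1)))).
    by rewrite ler_wpM2l//; lra.
  lra.
have lV : `|l - V F 0| <= 2 * eta.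
  have cV : V G k.+1%:R^-1 @[k --> \oo] --> V F 0.
    apply: cvg_sumr => i; apply: cvg_sumr => j; apply: cvgM; first exact: cvg_cst.
    by apply: cvgM; apply: cvgB; rewrite addr0; exact: GF_seq.
  have cV' : `|l - V G k.+1%:R^-1| @[k --> \oo] --> `|l - V F 0|.
    by apply: cvg_norm; apply: cvgB => //; exact: cvg_cst.
  apply: (cvgr_to_le cV').
  have d2 : 0 < del / 2 by rewrite divr_gt0.
  have /cvgrPdist_le/(_ _ d2) := @cvg_harmonic R.
  apply: filterS => k; rewrite sub0r normrN /harmonic /= ger0_norm ?invr_ge0// => kd.
  by apply: GV => //; rewrite invf_le1// ler1n.
suff : `|I - V F 0| <= 2 * eta.
  move=> IV; have := ler_distD (V F 0) l I; rewrite [`|V F 0 - I|]distrC; lra.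
have VE : V F 0 = \int[mu]_z step2 psi xg 0 N z.1 z.2.
  rewrite (Rintegral_step2 PF psi N xg_nd).2 /V.
  by apply: eq_bigr => i _; apply: eq_bigr => j _; rewrite !addr0.
have FK : M * (2 * (1 - (F K - F (- K)))) <= eta.
  have h1 := GF K; have h2 : F (- K) <= G (- K + 1) by apply: FG; lra.
  by apply: le_trans tailG; rewrite ler_wpM2l//; lra.
have err0 x y : `|psi x y - step2 psi xg 0 N x y| <= M * (tail x 0 + tail y 0) + eta.
  by apply: err => //; rewrite divr_ge0// ltW.
have := @Rintegral_step2_error _ P F PF psi M eta xg N xg_nd mpsi psiM err0.
rewrite -VE xg0 xgN => /le_trans; apply; lra.
Qed.

End helly.

(** * Passing to the limit with polynomial growth *)
Section continuity.
Context {R : realType}.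
Implicit Types (p s u : R).

Lemma continuous_powR_gt0 p u : 0 < u -> {for u, continuous (@powR R ^~ p)}.
Proof.
move=> u0; apply/differentiable_continuous/derivable1_diffP.
by apply: derivable_powR; rewrite in_itv/= u0.
Qed.

Lemma continuous_normr_powR p : 0 < p -> continuous (fun x : R => `|x| `^ p).
Proof.
move=> p0 x; have [->|x0] := eqVneq x 0; last first.
  apply: (@continuous_comp _ _ _ (fun x : R => `|x|) (@powR R ^~ p)).
    exact: norm_continuous.
  by apply: continuous_powR_gt0; rewrite normr_gt0.
apply/cvgrPdist_le => e e0; rewrite normr0 powR0 ?gt_eqF//.
exists (e `^ p^-1) => /=; first exact: powR_gt0.
move=> y /=; rewrite !sub0r !normrN => ye.
rewrite ger0_norm ?powR_ge0//.
rewrite -[leRHS](powRr1 (ltW e0)) -(@mulVf _ p) ?gt_eqF// powRrM.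
by apply: ler_powR_base => //; exact: ltW.
Qed.

Lemma continuous_wt s : continuous (@wt R s).
Proof.
move=> x; apply: (@continuous_comp _ _ _ (fun x : R => 1 + x ^+ 2) (@powR R ^~ s)).
  by apply: cvgD; [exact: cvg_cst|exact: exprn_continuous].
by apply: continuous_powR_gt0; exact: wtb_gt0.
Qed.

Lemma measurable_wt s : measurable_fun setT (@wt R s : measurableTypeR R -> R).
Proof. by apply: continuous_measurable_fun; exact: continuous_wt. Qed.

Lemma continuous_fst2 (f : R -> R) : continuous f ->
  continuous (fun z : R * R => f z.1).
Proof. by move=> cf z; apply: continuous_comp; [exact: cvg_fst|exact: cf]. Qed.

Lemma continuous_snd2 (f : R -> R) : continuous f ->
  continuous (fun z : R * R => f z.2).
Proof. by move=> cf z; apply: continuous_comp; [exact: cvg_snd|exact: cf]. Qed.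

End continuity.

Section helly_growth.
Context {R : realType} (U : set_system nat).
Hypothesis UU : UltraFilter U.
Variables (E : nat -> (R -> R) -> R) (L : nat -> R) (A : R -> R).
Hypotheses (mE : forall n, is_mean (L n) (E n))
  (moments : forall n s, 1 <= s -> E n (wt s) <= A s).
Local Notation rR := (measurableTypeR R).
Implicit Types (psi : R -> R -> R) (f : R -> R) (K s : R).

Let A_ge0 s : 1 <= s -> 0 <= A s.
Proof.
move=> s1; apply: le_trans (moments 0%N s1).
by apply: (mean_ge0 (mE 0%N)) => x _; exact: wt_ge0.
Qed.

Let W s x y := wt s x * wt s y.

Let W_ge0 s x y : 0 <= W s x y.
Proof. by rewrite mulr_ge0// wt_ge0. Qed.

Let cW s : continuous (fun z : R * R => W s z.1 z.2).
Proof.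
by move=> z; apply: cvgM; [exact: continuous_fst2 (@continuous_wt R s) z
  |exact: continuous_snd2 (@continuous_wt R s) z].
Qed.

Let mW s : measurable_fun setT (fun z : rR * rR => W s z.1 z.2).
Proof.
by apply: measurable_funM; apply: measurableT_comp => //; exact: measurable_wt.
Qed.

Let EW n s : 1 <= s -> mean2 (E n) (W s) <= A s ^+ 2.
Proof.
move=> s1; rewrite (mean2M (mE n)) -expr2 lerXn2r ?nnegrE ?A_ge0 ?moments//.
by apply: (mean_ge0 (mE n)) => x _; exact: wt_ge0.
Qed.

Section limit.
Variable P : probability rR R.
Let mu := (P \x P)%E.
Hypothesis HP : forall psi M,
  continuous (fun z : R * R => psi z.1 z.2) ->
  measurable_fun setT (fun z : rR * rR => psi z.1 z.2) ->
  (forall x y, `|psi x y| <= M) ->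
  mean2 (E n) psi @[n --> U] --> \int[mu]_z psi z.1 z.2.

Let mu1 : mu setT = 1%E := product_probability_setT P.

(** Bounds on moments pass to the limit by truncation and monotone
    convergence. *)
Let integral_W s : 1 <= s -> (\int[mu]_z (W s z.1 z.2)%:E <= (A s ^+ 2)%:E)%E.
Proof.
move=> s1.
pose g (n : nat) (z : rR * rR) := (Num.min (W s z.1 z.2) n%:R)%:E.
have mg n : measurable_fun setT (fun z : rR * rR => Num.min (W s z.1 z.2) n%:R).
  by apply: measurable_minr; [exact: mW|exact: measurable_cst].
have g0 n z : 0 <= Num.min (W s z.1 z.2) n%:R by rewrite le_min W_ge0 ler0n.
have gn n : (\int[mu]_z g n z <= (A s ^+ 2)%:E)%E.
  have gb x y : `|Num.min (W s x y) n%:R| <= n%:R.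
    by rewrite ger0_norm ?(g0 n (x, y))// ge_min lexx orbT.
  have cg : continuous (fun z : R * R => Num.min (W s z.1 z.2) n%:R).
    by move=> z; apply: (@continuous_min _ _ (fun z : R * R => W s z.1 z.2) (fun=> n%:R)); [exact: cW|exact: cvg_cst].
  have lim_g := HP cg (mg n) gb.
  have ig : mu.-integrable setT (g n).
    by apply: (@bounded_integrable _ _ _ _ mu1 _ n%:R) => // z; exact: gb.
  rewrite -(fineK (integrable_fin_num _ ig))// lee_fin.
  apply: (cvg_ler lim_g (cvg_cst (A s ^+ 2))) => k.
  apply: le_trans (EW k s1); apply: (mean2_le (mE k)) => x y _ _.
  by rewrite ge_min lexx.
have mc := @monotone_convergence _ _ _ mu setT measurableT g.
have glim z : limn (g ^~ z) = (W s z.1 z.2)%:E.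
  apply/cvg_lim => //; apply: cvg_near_cst.
  exists (Num.truncn (W s z.1 z.2)).+1 => // k /= Wk.
  rewrite /g; congr EFin; apply/min_idPl.
  have /Num.Theory.truncn_itv/andP[_ /ltW h] := W_ge0 s z.1 z.2.
  by apply: (le_trans h); rewrite ler_nat.
have -> : (\int[mu]_z (W s z.1 z.2)%:E = \int[mu]_z limn (g ^~ z))%E.
  by apply: eq_integral => z _; rewrite glim.
have nd : {homo (fun n => \int[mu]_z g n z)%E : n m / (n <= m)%N >-> (n <= m)%E}.
  move=> n m nm; apply: ge0_le_integral => //.
  - by move=> z _; rewrite lee_fin.
  - exact/measurable_EFinP.
  - exact/measurable_EFinP.
  - move=> z _; rewrite lee_fin le_min ge_min lexx/= ge_min.
    by rewrite ler_nat nm orbT.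
rewrite mc.
- apply: lime_le; first exact: ereal_nondecreasing_is_cvgn.
  by apply: nearW => n; exact: gn.
- by move=> n; exact/measurable_EFinP.
- by move=> n z _; rewrite lee_fin.
- move=> z _ n m nm; rewrite lee_fin le_min ge_min lexx/= ge_min.
  by rewrite ler_nat nm orbT.
Qed.

Let integrable_W s : 1 <= s -> mu.-integrable setT (EFin \o (fun z => W s z.1 z.2)).
Proof.
move=> s1; apply/integrableP; split; first exact/measurable_EFinP.
apply: le_lt_trans (ltry (A s ^+ 2)); apply: le_trans (integral_W s1).
by under eq_integral do rewrite /= ger0_norm//.
Qed.

Let Rintegral_W s : 1 <= s -> \int[mu]_z W s z.1 z.2 <= A s ^+ 2.
Proof.
move=> s1; rewrite -lee_fin /Rintegral fineK; first exact: integral_W.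
exact: integrable_fin_num (integrable_W s1).
Qed.

Variables (psi : R -> R -> R) (K s : R).
Hypotheses (s1 : 1 <= s) (cpsi : continuous (fun z : R * R => psi z.1 z.2))
  (mpsi : measurable_fun setT (fun z : rR * rR => psi z.1 z.2))
  (psiK : forall x y, `|psi x y| <= K * (wt s x * wt s y)).

Let K_ge0 : 0 <= K.
Proof.
rewrite -(pmulr_lge0 _ (mulr_gt0 (wt_gt0 s 0) (wt_gt0 s 0))).
exact: le_trans (normr_ge0 _) (psiK 0 0).
Qed.

Lemma integrable_growth : mu.-integrable setT (EFin \o (fun z => psi z.1 z.2)).
Proof.
have h := integrableZl measurableT K (integrable_W s1).
apply: (le_integrable measurableT _ _ h); first exact/measurable_EFinP.
move=> z _ /=; rewrite lee_fin [leRHS]ger0_norm; first exact: psiK.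
by rewrite mulr_ge0.
Qed.

(* Truncation at level [c] costs at most [psi^2 / c]. *)
Let trunc c x y := Num.max (- c) (Num.min (psi x y) c).

Let trunc_err c x y : 0 < c -> `|psi x y - trunc c x y| <= K ^+ 2 / c * W (2 * s) x y.
Proof.
move=> c0; set p := psi x y.
have h1 : p ^+ 2 <= K ^+ 2 * W (2 * s) x y.
  have wt2 z : wt (2 * s) z = wt s z ^+ 2.
    by rewrite (_ : 2 * s = s + s) ?wtD//; ring.
  rewrite /W !wt2 -exprMn -exprMn -real_normK ?num_real//.
  by rewrite lerXn2r ?nnegrE// ?mulr_ge0 ?wt_ge0//; exact: psiK.
apply: (@le_trans _ _ (p ^+ 2 / c)); last first.
  by rewrite [leRHS]mulrAC ler_wpM2r// invr_ge0 ltW.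
rewrite ler_pdivlMr// /trunc -/p.
have p20 := sqr_ge0 p.
have [pc|cp] := leP p c.
  have [h|h] := leP (- c) p; first by rewrite subrr normr0 mul0r.
  rewrite ltr0_norm; last by lra.
  nra.
have h : - c <= c by lra.
have -> : Num.max (- c) c = c by apply/max_idPr.
rewrite gtr0_norm; last by lra.
nra.
Qed.

Lemma mean2_cvg_growth : mean2 (E n) psi @[n --> U] --> \int[mu]_z psi z.1 z.2.
Proof.
have [l _ psil] : exists2 l, `|l| <= K * A s ^+ 2 & mean2 (E n) psi @[n --> U] --> l.
  apply: ultra_bounded_cvg => //; apply: nearW => n.
  apply: (le_trans (mean2_norm (mE n) (fun x y _ _ => psiK x y))).
  by rewrite (mean2Z (mE n)) ler_wpM2l//; exact: EW.
have s2 : 1 <= 2 * s by have := s1; lra.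
pose Q := K ^+ 2 * A (2 * s) ^+ 2.
have Q0 : 0 <= Q by rewrite mulr_ge0// sqr_ge0.
set I := Rintegral _ _ _.
suff key c : 0 < c -> `|l - I| <= 2 * (Q / c).
  suff -> : I = l by [].
  apply/eqP; rewrite eq_sym -subr_eq0 -normr_le0; apply/ler_addgt0Pr => e e0.
  rewrite add0r; apply: (le_trans (key (2 * (Q + 1) / e) _)).
    by rewrite divr_gt0 ?mulr_gt0//; lra.
  rewrite invf_div mulrA mulrCA mulrA -ler_pdivlMr ?invr_gt0; last lra.
  rewrite invrK; nra.
move=> c0.
have tb x y : `|trunc c x y| <= c.
  by rewrite ler_norml /trunc le_max lexx/= ge_max ge_min lexx orbT andbT; lra.
have ct : continuous (fun z : R * R => trunc c z.1 z.2).
  move=> z; apply: (@continuous_max _ _ (fun=> - c) (fun z : R * R => Num.min (psi z.1 z.2) c)).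
    exact: cvg_cst.
  by apply: (@continuous_min _ _ (fun z : R * R => psi z.1 z.2) (fun=> c)); [exact: cpsi|exact: cvg_cst].
have mt : measurable_fun setT (fun z : rR * rR => trunc c z.1 z.2).
  by apply: measurable_maxr => //; apply: measurable_minr.
have lt := HP ct mt tb; set J := Rintegral _ _ _ in lt.
have lJ : `|l - J| <= Q / c.
  have cl : `|mean2 (E n) psi - mean2 (E n) (trunc c)| @[n --> U] --> `|l - J|.
    by apply: cvg_norm; exact: cvgB.
  apply: (cvg_ler cl (cvg_cst (Q / c))) => n.
  rewrite -(mean2B (mE n)).
  apply: (le_trans (mean2_norm (mE n) (fun x y _ _ => trunc_err x y c0))).
  rewrite (mean2Z (mE n)) /Q [leRHS]mulrAC ler_wpM2l ?EW//.
  by rewrite divr_ge0 ?sqr_ge0// ltW.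
have it : mu.-integrable setT (EFin \o (fun z => trunc c z.1 z.2)).
  exact: (@bounded_integrable _ _ _ _ mu1 _ c).
have IJ : `|I - J| <= Q / c.
  have iB := integrableB measurableT integrable_growth it.
  rewrite /I /J -(RintegralB measurableT integrable_growth it).
  apply: (le_trans (le_normr_Rintegral measurableT iB)).
  have iW := integrable_W s2.
  apply: (@le_trans _ _ (\int[mu]_z (K ^+ 2 / c * W (2 * s) z.1 z.2))).
    apply: le_Rintegral => //.
    - exact: (integrable_norm iB).
    - exact: (integrableZl measurableT _ iW).
    - by move=> z _; exact: trunc_err.
  rewrite (RintegralZl _ measurableT iW) /Q [leRHS]mulrAC ler_wpM2l ?Rintegral_W//.
  by rewrite divr_ge0 ?sqr_ge0// ltW.
have := ler_distD J l I; rewrite [`|J - I|]distrC; lra.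
Qed.

End limit.

End helly_growth.

(** Two independent copies are needed because the collision operator is
    quadratic, and polynomial growth because the collision rate is unbounded. *)
Definition is_mean_limit {R : realType} (U : set_system nat)
    (E : nat -> (R -> R) -> R) (P : probability (measurableTypeR R) R) :=
  forall (psi : R -> R -> R) (K s : R), 1 <= s ->
  continuous (fun z : R * R => psi z.1 z.2) ->
  measurable_fun setT (fun z : measurableTypeR R * measurableTypeR R => psi z.1 z.2) ->
  (forall x y, `|psi x y| <= K * (wt s x * wt s y)) ->
  (P \x P)%E.-integrable setT (EFin \o (fun z => psi z.1 z.2)) /\
  mean2 (E n) psi @[n --> U] --> \int[(P \x P)%E]_z psi z.1 z.2.

(** Bounded moments of all orders give tightness, hence a limit on bounded test
    functions, and uniform integrability, hence the growth. *)
Lemma helly {R : realType} (U : set_system nat) (UU : UltraFilter U)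
    (E : nat -> (R -> R) -> R) (L : nat -> R) (A : R -> R) :
  (forall n, is_mean (L n) (E n)) ->
  (forall n s, 1 <= s -> E n (wt s) <= A s) ->
  exists P : probability (measurableTypeR R) R, is_mean_limit U E P.
Proof.
move=> mE moments.
have [P HP] := helly_bounded UU mE (fun n => moments n _ (lexx 1)).
exists P => psi K s s1 cpsi mpsi psiK; split.
  exact: (integrable_growth UU mE moments HP s1 mpsi psiK).
exact: (mean2_cvg_growth UU mE moments HP s1 cpsi mpsi psiK).
Qed.

Lemma is_mean_limit1 {R : realType} (U : set_system nat) (L : nat -> R)
    (E : nat -> (R -> R) -> R) (P : probability (measurableTypeR R) R)
    (f : R -> R) (K s : R) :
  (forall n, is_mean (L n) (E n)) -> is_mean_limit U E P -> 1 <= s ->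
  continuous f -> (forall x, `|f x| <= K * wt s x) ->
  P.-integrable setT (EFin \o f) /\ E n f @[n --> U] --> \int[P]_x f x.
Proof.
move=> mE HP s1 cf fK.
have mf : measurable_fun setT (f : measurableTypeR R -> R).
  exact: continuous_measurable_fun.
have mf1 : measurable_fun setT (fun z : measurableTypeR R * measurableTypeR R => f z.1).
  exact: measurableT_comp mf measurable_fst.
have s0 : 0 <= s by rewrite (le_trans _ s1).
have bd x y : `|f x| <= K * (wt s x * wt s y).
  apply: (le_trans (fK x)); rewrite mulrA ler_peMr ?wt_ge1//.
  exact: le_trans (normr_ge0 _) (fK x).
have [i1 l1] := HP _ K s s1 (continuous_fst2 cf) mf1 bd.
have ip := (integrable_law measurable_fst (law_fst P) mf).2 i1.
split => //; rewrite -(Rintegral_law measurable_fst (law_fst P) mf ip).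
by under eq_fun do rewrite -(mean2_fst (mE _)).
Qed.

(** * Discretization of the initial datum *)
Import HBNNSimple.

Section discretization.
Context {R : realType}.
Local Notation rR := (measurableTypeR R).

Lemma rounding : exists T : nat -> rR -> R, [/\
  forall n, measurable_fun setT (T n),
  forall n, exists s : seq R, forall x, T n x \in s,
  forall n x, `|T n x| <= `|x| &
  forall x, T n x @[n --> \oo] --> (x : R)].
Proof.
have pos (f : R -> R) : measurable_fun setT (f : rR -> R) -> (forall x, 0 <= f x) ->
  exists g : nat -> rR -> R, [/\ forall n, measurable_fun setT (g n),
    forall n, exists s : seq R, forall x, g n x \in s,
    forall n x, 0 <= g n x <= f x & forall x, g n x @[n --> \oo] --> (f x : R)].
  move=> mf f0.
  have mfE : measurable_fun setT (EFin \o (f : rR -> R)) by exact/measurable_EFinP.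
  have [|g [g_nd g_cvg]] := approximation measurableT mfE.
    by move=> x _; rewrite lee_fin.
  have g_cvg' x : g n x @[n --> \oo] --> (f x : R).
    exact: (fine_cvg (g_cvg x Logic.I)).
  exists (fun n => g n : rR -> R); split => //.
  - move=> n; have /finite_seqP[s rs] := fimfunP (g n).
    exists s => x; have : range (g n) (g n x) by exists x.
    by rewrite rs.
  - move=> n x; rewrite fun_ge0/=.
    rewrite -(cvg_lim _ (g_cvg' x))//; apply: nondecreasing_cvgn_le.
      by move=> i j ij; exact: (lefP _ _ (g_nd i j ij) x).
    by apply/cvg_ex; exists (f x); exact: g_cvg'.
have mp : measurable_fun setT (fun x : rR => Num.max (x : R) 0).
  by apply: measurable_maxr => //; exact: measurable_cst.
have mn : measurable_fun setT (fun x : rR => Num.max (- (x : R)) 0).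
  by apply: measurable_maxr; [exact: measurable_funN|exact: measurable_cst].
have [|g [mg sg bg cg]] := pos _ mp; first by move=> x; rewrite le_max lexx orbT.
have [|h [mh sh bh ch]] := pos _ mn; first by move=> x; rewrite le_max lexx orbT.
exists (fun n x => g n x - h n x); split.
- by move=> n; exact: measurable_funB.
- move=> n; have [s1 h1] := sg n; have [s2 h2] := sh n.
  by exists [seq u - v | u <- s1, v <- s2] => x; apply: allpairs_f.
- move=> n x; have := bg n x; have := bh n x.
  have [x0|x0] := leP 0 (x : R).
    rewrite (_ : Num.max (- (x : R)) 0 = 0); last by apply/max_idPr; rewrite oppr_le0.
    move=> /andP[h0 h1] /andP[g0 g1].
    have -> : h n x = 0 by apply/eqP; rewrite eq_le h1 h0.
    by rewrite subr0 !ger0_norm.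
  rewrite (_ : Num.max (- (x : R)) 0 = - x); last by apply/max_idPl; rewrite oppr_ge0 ltW.
  move=> /andP[h0 h1] /andP[g0 g1].
  have -> : g n x = 0 by apply/eqP; rewrite eq_le g1 g0.
  by rewrite sub0r normrN ger0_norm// ltr0_norm.
- move=> x.
  have e : Num.max (x : R) 0 - Num.max (- (x : R)) 0 = x.
    have [x0|x0] := leP 0 (x : R).
      by have /max_idPr -> : - (x : R) <= 0; rewrite ?oppr_le0// subr0.
    have /max_idPl -> : 0 <= - (x : R) by rewrite oppr_ge0 ltW.
    by rewrite opprK add0r.
  by rewrite -[X in _ --> X]e; apply: cvgB; [exact: cg|exact: ch].
Qed.

Lemma dominated_cvg_Rintegral d (T : measurableType d) (mu : {measure set T -> \bar R})
    (f_ : nat -> T -> R) (f g : T -> R) :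
  (forall n, measurable_fun setT (f_ n)) -> measurable_fun setT f ->
  (forall x, f_ n x @[n --> \oo] --> f x) ->
  mu.-integrable setT (EFin \o g) -> (forall n x, `|f_ n x| <= g x) ->
  \int[mu]_x f_ n x @[n --> \oo] --> \int[mu]_x f x.
Proof.
move=> mf_ mf f_f ig fg.
have [||||| i _ c] := @dominated_convergence _ _ _ mu setT measurableT
    (fun n => EFin \o f_ n) (EFin \o f) (EFin \o g).
- by move=> n; exact/measurable_EFinP.
- exact/measurable_EFinP.
- by apply: aeW => x _; apply: cvg_EFin; [apply: nearW|exact: f_f].
- exact: ig.
- by apply: aeW => x n _; rewrite /= lee_fin.
apply: fine_cvg; rewrite fineK//; exact: integrable_fin_num i.
Qed.

(** A random variable with finitely many values has an expectation against
    every function, which is why the initial datum is discretized. *)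
Section simple_mean.
Variables (P : probability rR R) (T : rR -> R) (s : seq R) (m : R).
Hypotheses (mT : measurable_fun setT T) (Ts : forall x, T x \in s).

Let B y : set rR := T @^-1` [set y].

Let mB y : measurable (B y).
Proof. by rewrite -[B y]setTI; apply: mT. Qed.

Definition simple_mean (f : R -> R) : R :=
  \sum_(y <- undup s) f (y - m) * fine (P (B y)).

Let sumE (f : R -> R) : (fun x => f (T x - m)) =
  (fun x => \sum_(y <- undup s) f (y - m) * \1_(B y) x).
Proof.
apply/funext => x.
rewrite (bigD1_seq (T x)) ?mem_undup ?undup_uniq//= indicE mem_set// mulr1.
rewrite big1 ?addr0// => y yT; rewrite indicE memNset ?mulr0// => Ty.
by rewrite -Ty eqxx in yT.
Qed.

Let P1 : P setT = 1%E := probability_setT P.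

Let iterm (f : R -> R) y : P.-integrable setT (EFin \o (fun x => f (y - m) * \1_(B y) x)).
Proof.
apply: (@bounded_integrable _ _ _ _ P1 _ `|f (y - m)|).
  by apply: measurable_funM; [exact: measurable_cst|exact: measurable_indic].
by move=> x; rewrite normrM indicE; case: (_ \in _); rewrite ?normr1 ?normr0 ?mulr1 ?mulr0.
Qed.

Lemma simple_mean_integrable f : P.-integrable setT (EFin \o (fun x => f (T x - m))).
Proof. by rewrite sumE; exact: (Rintegral_sum P1 _ (iterm f)).1. Qed.

Lemma simple_meanE f : simple_mean f = \int[P]_x f (T x - m).
Proof.
rewrite sumE (Rintegral_sum P1 _ (iterm f)).2; apply: eq_bigr => y _.
rewrite RintegralZl ?Rintegral_indicator//.
apply: (@bounded_integrable _ _ _ _ P1 _ 1); first exact: measurable_indic.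
by move=> x; rewrite indicE; case: (_ \in _); rewrite ?normr1 ?normr0.
Qed.

Lemma simple_mean_is_mean : is_mean (\sum_(y <- s) `|y - m|) simple_mean.
Proof.
split.
- move=> c f g; rewrite /simple_mean big_distrr -big_split /=.
  by apply: eq_bigr => y _; rewrite mulrDl mulrA.
- rewrite simple_meanE Rintegral_cst// mul1r.
  by rewrite -[RHS]/(fine 1%:E); congr fine.
- move=> f g fg; rewrite /simple_mean big_seq [leRHS]big_seq.
  apply: ler_sum => y; rewrite mem_undup => ys.
  rewrite ler_wpM2r ?fine_ge0//; apply: fg.
  by rewrite (big_rem y)//= lerDl sumr_ge0.
Qed.

End simple_mean.

Variable mu0 : probability rR R.
Hypotheses (mom0 : forall s, mu0.-integrable setT (EFin \o (wt s : rR -> R)))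
  (mean0 : \int[mu0]_x (x : R) = 0).

Let imom0 : mu0.-integrable setT (EFin \o (fun x : rR => `|x : R|)).
Proof.
apply: (le_integrable measurableT _ _ (mom0 1)).
  by apply/measurable_EFinP; exact: measurableT_comp.
move=> x _ /=; rewrite lee_fin normr_id (ger0_norm (wt_ge0 _ _)).
rewrite /wt powRr1; last by rewrite ltW// wtb_gt0.
by rewrite -[x ^+ 2]real_normK ?num_real//; nra.
Qed.

(** Rounding towards zero keeps moments bounded; subtracting the mean of the
    rounded variable, which tends to zero, restores the centring exactly. *)
Lemma initial_means : exists (E : nat -> (R -> R) -> R) (L : nat -> R) (A : R -> R), [/\
  forall n, is_mean (L n) (E n), forall n, E n id = 0,
  forall n s, 1 <= s -> E n (wt s) <= A s &
  forall f K s, 1 <= s -> continuous f -> (forall x, `|f x| <= K * wt s x) ->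
    E n f @[n --> \oo] --> \int[mu0]_x f x].
Proof.
have [T [mT finT T_le T_cvg]] := rounding.
have /choice[s Ts] := finT.
pose m n := \int[mu0]_x T n x.
pose mb := \int[mu0]_x `|x : R|.
have iT n : mu0.-integrable setT (EFin \o T n).
  have := simple_mean_integrable mu0 0 (mT n) (Ts n) id.
  by under [X in EFin \o X]eq_fun do rewrite subr0.
have m_le n : `|m n| <= mb.
  apply: (le_trans (le_normr_Rintegral measurableT (iT n))).
  by apply: le_Rintegral => //; exact: (integrable_norm (iT n)).
have m_cvg : m n @[n --> \oo] --> (0 : R).
  rewrite -mean0; apply: (dominated_cvg_Rintegral mT _ T_cvg imom0) => //.
have wt_T n s' x : 0 <= s' -> wt s' (T n x - m n) <= 2 `^ s' * wt s' mb * wt s' x.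
  move=> s0; apply: (le_trans (wt_sub _ _ s0)).
  rewrite -mulrA ler_wpM2l ?powR_ge0// mulrC.
  by apply: ler_pM; [exact: wt_ge0|exact: wt_ge0|exact: wt_le_norm|exact: wt_even_le].
exists (fun n => simple_mean mu0 (T n) (s n) (m n)).
exists (fun n => \sum_(y <- s n) `|y - m n|).
exists (fun s' => \int[mu0]_x (2 `^ s' * wt s' mb * wt s' x)).
have sE n := simple_meanE mu0 (m n) (mT n) (Ts n).
split.
- by move=> n; exact: simple_mean_is_mean.
- move=> n; rewrite sE RintegralB//; last first.
    by apply: (@bounded_integrable _ _ _ _ (probability_setT mu0) _ `|m n|).
  rewrite Rintegral_cst// (_ : fine _ = fine 1%:E) ?mulr1 ?subrr//.
  by congr fine; exact: probability_setT.
- move=> n s' s1; rewrite sE; apply: le_Rintegral => //.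
  + exact: simple_mean_integrable.
  + exact: (integrableZl measurableT _ (mom0 s')).
  + by move=> x _; apply: wt_T; rewrite (le_trans _ s1).
- move=> f K s' s1 cf fK.
  have mf : measurable_fun setT (f : rR -> R) by exact: continuous_measurable_fun.
  have K0 : 0 <= K.
    by rewrite -(pmulr_lge0 _ (wt_gt0 s' 0)) (le_trans (normr_ge0 _) (fK 0)).
  under eq_fun do rewrite sE.
  apply: (@dominated_cvg_Rintegral _ rR mu0 (fun n x => f (T n x - m n)) f (fun x => K * (2 `^ s' * wt s' mb) * wt s' x)).
  + move=> n; apply: (measurableT_comp mf).
    by apply: measurable_funB => //; exact: measurable_cst.
  + exact: mf.
  + move=> x.
    have h : T n x - m n @[n --> \oo] --> (x : R) - 0 by apply: cvgB.
    by rewrite subr0 in h; exact: (cvg_comp _ _ h (cf x)).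
  + exact: (integrableZl measurableT _ (mom0 s')).
  + move=> n x; apply: (le_trans (fK _)); rewrite -mulrA ler_wpM2l//.
    by apply: wt_T; rewrite (le_trans _ s1).
Qed.

End discretization.

(** * Integrating a second order expansion *)
Section taylor.
Context {R : realType}.
Implicit Types (r t e d h x y : R).
Variables (Phi q : R -> R) (C : R).
Hypotheses
  (taylor : forall r t, 0 <= r -> 0 <= t ->
     `|Phi t - Phi r - (t - r) * q r| <= C * (t - r) ^+ 2)
  (lip : forall r t, 0 <= r -> 0 <= t -> `|q t - q r| <= C * `|t - r|).

Let C_ge0 : 0 <= C.
Proof. by have := lip (lexx 0) ler01; rewrite subr0 normr1 mulr1; apply: le_trans. Qed.

Let small e : 0 < e -> 0 < e / (C + 1).
Proof. by move=> e0; rewrite divr_gt0// ltr_wpDl. Qed.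

Let smallP e d : 0 < e -> `|d| < e / (C + 1) -> C * `|d| <= e.
Proof.
move=> e0; rewrite ltr_pdivlMr ?ltr_wpDl// => h.
have := normr_ge0 d; lra.
Qed.

Lemma taylor_within : {within `[0, +oo[, continuous q}.
Proof.
apply/subspace_continuousP => x; rewrite /= in_itv/= andbT => x0.
apply/cvgrPdist_le => e e0.
exists (e / (C + 1)) => /=; first exact: small.
move=> y /= xy; rewrite in_itv/= andbT => y0.
by apply: (le_trans (lip y0 x0)); exact: smallP.
Qed.

Lemma taylor_continuous r : 0 <= r ->
  forall e, 0 < e -> exists2 d, 0 < d &
    forall t, 0 <= t -> `|r - t| < d -> `|Phi r - Phi t| <= e.
Proof.
move=> r0 e e0; pose M := C + `|q r| + 1.
have M0 : 0 < M by have := C_ge0; have := normr_ge0 (q r); rewrite /M; lra.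
exists (Num.min 1 (e / M)); first by rewrite lt_min ltr01 divr_gt0.
move=> t t0; rewrite lt_min => /andP[rt1 rte].
have h := taylor r0 t0; rewrite distrC.
have -> : Phi t - Phi r = (Phi t - Phi r - (t - r) * q r) + (t - r) * q r by rewrite subrK.
apply: (le_trans (ler_normD _ _)).
rewrite normrM [`|t - r|]distrC.
move: h; rewrite -[(t - r) ^+ 2]real_normK ?num_real// [`|t - r|]distrC => h.
move: rte; rewrite ltr_pdivlMr// => rte.
have c0 := C_ge0; have n0 := normr_ge0 (r - t); have q0 := normr_ge0 (q r).
have : C * `|r - t| ^+ 2 <= C * `|r - t|.
  by rewrite ler_wpM2l// expr2 ler_piMr// ltW.
rewrite /M in rte; nra.
Qed.

Lemma taylor_derive r : 0 < r ->
  (fun h => h^-1 *: (Phi (h *: 1 + r) - Phi r)) @ 0^' --> q r.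
Proof.
move=> r0; apply/cvgrPdist_le => e e0.
exists (Num.min r (e / (C + 1))) => /=; first by rewrite lt_min r0 small.
move=> h /=; rewrite sub0r normrN lt_min => /andP[hr he] h0.
rewrite [h *: 1]mulr1 -[h^-1 *: _]/(h^-1 * (Phi (h + r) - Phi r)).
have hr0 : 0 <= h + r by have := ler_norm (- h); rewrite normrN; lra.
have := taylor (ltW r0) hr0; rewrite addrK => T.
rewrite -(ler_pM2l (x := `|h|)) ?normr_gt0// -normrM mulrBr.
rewrite mulrA mulfV// mul1r distrC (le_trans T)//.
rewrite -real_normK ?num_real// expr2 mulrCA ler_wpM2l//.
exact: smallP.
Qed.

(** The expansion makes [q] the derivative of [Phi], and the Lipschitz bound makes
    it continuous, so that the fundamental theorem of calculus applies. *)
Lemma taylor_integral t : 0 <= t ->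
  (@lebesgue_measure R).-integrable `[0, t] (EFin \o q) /\
  Phi t = Phi 0 + \int[lebesgue_measure]_(s in `[0, t]) q s.
Proof.
move=> t0.
have cq : {within `[0, t], continuous q}.
  apply: continuous_subspaceW taylor_within => x; rewrite /= !in_itv/= andbT.
  by case/andP.
split.
  by apply: continuous_compact_integrable => //; exact: segment_compact.
move: t0; rewrite le_eqVlt => /predU1P[<-|t0].
  by rewrite set_itv1 Rintegral_set1 addr0.
rewrite /Rintegral (@continuous_FTC2 _ q Phi)//; first by rewrite -EFinB /= [RHS]addrC subrK.
- split.
  + move=> r; rewrite in_itv/= => /andP[r0 _].
    by apply/cvg_ex; exists (q r); exact: taylor_derive.
  + apply/cvgrPdist_le => e e0; have [d d0 dP] := taylor_continuous (lexx 0) e0.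
    by exists d => //= y yd y0; apply: dP => //; exact: ltW.
  + apply/cvgrPdist_le => e e0; have [d d0 dP] := taylor_continuous (ltW t0) e0.
    exists (Num.min t d) => /=; first by rewrite lt_min t0.
    move=> y /=; rewrite lt_min => /andP[yt yd] ty; apply: dP => //.
    by move: yt; rewrite gtr0_norm ?subr_gt0//; lra.
- move=> r; rewrite in_itv/= => /andP[r0 _].
  rewrite derive1E; apply/cvg_lim => //; exact: taylor_derive.
Qed.

End taylor.

(** * Construction of a solution with all moments *)
Section solution.
Context {R : realType} (a gamma : R).
Hypotheses (ha : 0 < a < 1) (hgamma : 0 < gamma).
Local Notation rR := (measurableTypeR R).
Implicit Types (r t s p K x y e : R) (f : R -> R).

Section time_step.
Variable L : nat -> R.

(** Small enough for positivity, and tending to zero. *)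
Definition scheme_step n : R := n.+2%:R^-1 * (1 + (2 * L n) `^ gamma)^-1.

Definition scheme_index n t : nat := Num.truncn (t / scheme_step n).

Let pos n : 0 < 1 + (2 * L n) `^ gamma.
Proof. by rewrite ltr_pwDl// powR_ge0. Qed.

Lemma scheme_step_gt0 n : 0 < scheme_step n.
Proof. by rewrite mulr_gt0 ?invr_gt0. Qed.

Lemma scheme_step_ge0 n : 0 <= scheme_step n.
Proof. exact: ltW (scheme_step_gt0 n). Qed.

Lemma scheme_step_le n : scheme_step n <= n.+2%:R^-1.
Proof.
by rewrite -[leRHS]mulr1 ler_wpM2l ?invr_ge0// invf_le1// lerDl powR_ge0.
Qed.

Lemma scheme_stepL n : scheme_step n * (2 * L n) `^ gamma <= 1.
Proof.
rewrite /scheme_step -mulrA mulrC -ler_pdivlMr ?invr_gt0// invrK mul1r.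
apply: (@le_trans _ _ 1); last by rewrite ler1n.
by rewrite mulrC ler_pdivrMr// mul1r lerDr.
Qed.

End time_step.

Section from_scheme.
Variables (mu0 : probability rR R) (U : set_system nat).
Hypotheses (mom0 : forall s, mu0.-integrable setT (EFin \o (wt s : rR -> R)))
  (mean0 : \int[mu0]_x (x : R) = 0).
Hypotheses (UU : UltraFilter U) (U_oo : \oo `<=` U).
Variables (E0 : nat -> (R -> R) -> R) (L : nat -> R) (A : R -> R).
Hypotheses (mE0 : forall n, is_mean (L n) (E0 n)) (E0_id : forall n, E0 n id = 0)
  (momA : forall n s, 1 <= s -> E0 n (wt s) <= A s)
  (E0_cvg : forall f K s, 1 <= s -> continuous f -> (forall x, `|f x| <= K * wt s x) ->
    E0 n f @[n --> \oo] --> \int[mu0]_x f x).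

Let cvgU (u : nat -> R) (l : R) : u n @[n --> \oo] --> l -> u n @[n --> U] --> l.
Proof. by move=> ul B lB; apply: U_oo; exact: ul. Qed.

Local Notation h := (scheme_step L).

Let h_gt0 := scheme_step_gt0 L.
Let h_ge0 := scheme_step_ge0 L.
Let h_le := scheme_step_le L.
Let hL := scheme_stepL L.

Let h_half n : h n <= 2^-1.
Proof. by apply: (le_trans (h_le n)); rewrite lef_pV2 ?posrE// ler_nat. Qed.

Let h_cvg : h n @[n --> U] --> (0 : R).
Proof.
apply: cvgU; apply/cvgrPdist_le => e e0.
have /cvgrPdist_le/(_ _ e0) := @cvg_harmonic R.
apply: filterS => n; rewrite !sub0r !normrN /harmonic /= !ger0_norm ?invr_ge0//.
move/(le_trans _); apply; apply: (le_trans (h_le n)).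
by rewrite lef_pV2 ?posrE// ler_nat.
Qed.

Local Notation k := (scheme_index L).
Local Notation S n t := (euler a gamma (h n) (E0 n) (k n t)).

Let kh t n : 0 <= t -> (k n t)%:R * h n <= t < (k n t)%:R * h n + h n.
Proof.
move=> t0; have : 0 <= t / h n by rewrite divr_ge0.
move=> /Num.Theory.truncn_itv/andP[].
rewrite ler_pdivlMr// ltr_pdivrMr// -/(k n t) -[_.+1]addn1 natrD mulrDl mul1r.
by move=> -> ->.
Qed.

Let kh_cvg t : 0 <= t -> (k n t)%:R * h n @[n --> U] --> t.
Proof.
move=> t0; apply/cvgrPdist_le => e e0.
have /cvgrPdist_le/(_ _ e0) := h_cvg.
apply: filterS => n; rewrite sub0r normrN ger0_norm// => he.
have /andP[h1 h2] := kh n t0.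
by rewrite ger0_norm ?subr_ge0//; lra.
Qed.

Let mS n t : is_mean (L n) (S n t).
Proof. exact: euler_mean. Qed.

Let S_wt n t s : 1 <= s -> S n t (wt s) <= A s.
Proof. by move=> s1; apply: (euler_wt ha hgamma (mE0 n)) => // s' /momA. Qed.

Variable nu : R -> probability rR R.
Hypothesis nuS : forall t, is_mean_limit U (fun n => S n t) (nu t).

Let nu1 t f K s : 1 <= s -> continuous f -> (forall x, `|f x| <= K * wt s x) ->
  (nu t).-integrable setT (EFin \o f) /\ S n t f @[n --> U] --> \int[nu t]_x f x.
Proof.
move=> s1 cf fK; exact: (is_mean_limit1 (fun n => mS n t) (nuS t) s1 cf fK).
Qed.

(** Convex moments, such as the moment norm, decrease along the scheme. *)
Let nu_noninc t f K s : 1 <= s -> continuous f -> (forall x, `|f x| <= K * wt s x) ->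
  (forall x y, gain a f x y <= 0) -> \int[nu t]_x f x <= \int[mu0]_x f x.
Proof.
move=> s1 cf fK f0.
apply: (cvg_ler (nu1 t s1 cf fK).2 (cvgU (E0_cvg s1 cf fK))) => n.
exact: (euler_noninc ha hgamma (mE0 n)).
Qed.

Let abs_wt p x : 0 <= p -> `| `|x| `^ p | <= 1 * wt (p / 2) x.
Proof. by move=> p0; rewrite mul1r ger0_norm ?powR_ge0// normr_powR_le_wt. Qed.

Let abs_wt1 x : `|x| <= 1 * wt 1 x.
Proof.
rewrite mul1r /wt powRr1; last by rewrite ltW// wtb_gt0.
by rewrite -[x ^+ 2]real_normK ?num_real//; nra.
Qed.

Lemma nu_mean_zero t : \int[nu t]_x (x : R) = 0.
Proof.
have cid : continuous (id : R -> R) by move=> x; exact: cvg_id.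
have [_ c] := nu1 t (lexx 1) cid abs_wt1.
have c0 : S n t id @[n --> U] --> (0 : R).
  have e n : S n t id = 0 by rewrite (euler_id ha hgamma (mE0 n)).
  by under eq_fun do rewrite e; exact: cvg_cst.
exact: (cvg_unique _ c c0).
Qed.

Lemma nu_decay p : 2 <= p -> exists2 D, 0 < D & forall t, 0 <= t ->
  (nu t).-integrable setT (EFin \o (fun x : rR => `|x : R| `^ p)) /\
  \int[nu t]_x (`|x : R| `^ p) <= (D / (1 + t)) `^ (p / gamma).
Proof.
move=> p2; have g0 := hgamma.
have p0 : 0 < p by lra.
have hp : 1 <= p / 2 by lra.
have ca := continuous_normr_powR p0.
pose D := decay_cst a gamma p (A (p / 2)).
have D0 : 0 < D by exact: decay_cst_gt0.
exists (2 * D) => [|t t0]; first by rewrite mulr_gt0.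
have [ia c] := nu1 t hp ca (fun x => abs_wt x (ltW p0)); split => //.
apply: (cvg_ler c (cvg_cst ((2 * D / (1 + t)) `^ (p / gamma)))) => n.
have B0 : E0 n (fun x => `|x| `^ p) <= A (p / 2).
  apply: le_trans (momA n hp); apply: (mean_le (mE0 n)) => x _.
  by apply: normr_powR_le_wt; exact: ltW.
apply: (le_trans (euler_absp_decay ha hgamma (mE0 n) (h_ge0 n) (hL n) (E0_id n) (k n t) p2 B0)).
have T0 : 0 < 1 + (k n t)%:R * h n by rewrite ltr_pwDl// mulr_ge0.
apply: ler_powR_base.
- by rewrite divr_ge0// ltW.
- by rewrite divr_ge0 ?(ltW D0) ?(ltW T0).
have /andP[_ h2] := kh n t0; have h3 := h_half n.
have h4 : 1 + t <= 2 * (1 + (k n t)%:R * h n) by lra.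
rewrite -/D ler_pdivrMr// mulrAC ler_pdivlMr; last lra.
by have := ler_wpM2l (ltW D0) h4; lra.
Qed.

Lemma nu_lower : 0 < (\int[mu0]_x `|x : R|) -> exists2 c, 0 < c & forall t, 0 <= t ->
  c <= (\int[nu t]_x `|x : R|) * (1 + t) `^ gamma^-1.
Proof.
move=> m0; have g0 := hgamma.
set m := Rintegral _ _ _ in m0.
have m20 : 0 < m / 2 by rewrite divr_gt0.
have q1 : 1 <= (gamma + 2) / 2 by lra.
have [[c h1] /= [c0 h10] H] := euler_normr_lower ha hgamma (A ((gamma + 2) / 2)) m20.
exists c => // t t0.
have cn : continuous (fun x : R => `|x|) by exact: norm_continuous.
have nb x : `| `|x : R| | <= 1 * wt 1 x by rewrite normr_id; exact: abs_wt1.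
have [_ cS] := nu1 t (lexx 1) cn nb.
have cM : S n t Num.norm * (1 + t) `^ gamma^-1 @[n --> U] -->
    (\int[nu t]_x `|x : R|) * (1 + t) `^ gamma^-1.
  by apply: cvgM; [exact: cS|exact: cvg_cst].
apply: (cvgr_to_ge cM).
have /cvgrPdist_le/(_ _ m20) cm := cvgU (E0_cvg (lexx 1) cn nb).
have /cvgrPdist_le/(_ _ h10) ch := h_cvg.
apply: filterS2 cm ch => n.
rewrite ler_norml => /andP[_ hm]; rewrite sub0r normrN ger0_norm// => hh.
have B0 : E0 n (fun x => `|x| `^ (gamma + 2)) <= A ((gamma + 2) / 2).
  apply: le_trans (momA n q1); apply: (mean_le (mE0 n)) => x _.
  by apply: normr_powR_le_wt; lra.
have hm' : m / 2 <= E0 n Num.norm by rewrite /m in hm *; lra.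
apply: (le_trans (H _ _ _ (mE0 n) (h_ge0 n) (hL n) hh (E0_id n) B0 hm' (k n t))).
rewrite ler_wpM2l//; first by apply: (mean_ge0 (mS n t)).
have /andP[h2 _] := kh n t0.
apply: ler_powR_base; rewrite ?invr_ge0 ?(ltW g0) ?lerD2l//.
by rewrite addr_ge0// mulr_ge0.
Qed.

Section test_function.
Variables (phi : R -> R) (K : R).
Hypotheses (cphi : continuous phi) (phiK : forall x, `|phi x| <= K).

Let K_ge0 : 0 <= K := le_trans (normr_ge0 _) (phiK 0).

Let phi_wt x : `|phi x| <= K * wt 1 x.
Proof. by apply: (le_trans (phiK x)); rewrite ler_peMr// wt_ge1. Qed.

Let s1 : 1 <= 1 + gamma / 2.
Proof. by have := hgamma; lra. Qed.

Let psi := rate_gain a gamma phi.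

Let cpsi : continuous (fun z : R * R => psi z.1 z.2).
Proof.
move=> z.
have c1 : {for z, continuous (fun z : R * R => z.1)} by exact: cvg_fst.
have c2 : {for z, continuous (fun z : R * R => z.2)} by exact: cvg_snd.
have lin u v : {for z, continuous (fun z : R * R => u * z.1 + v * z.2)}.
  by apply: cvgD; apply: cvgM => //; exact: cvg_cst.
apply: cvgM.
  apply: (@continuous_comp _ _ _ (fun z : R * R => z.1 - z.2) (fun x => `|x| `^ gamma)).
    exact: cvgB.
  exact: continuous_normr_powR.
apply: cvgB; [apply: cvgB; [apply: cvgD|]|].
- by apply: (@continuous_comp _ _ _ (fun z : R * R => a * z.1 + (1 - a) * z.2) phi); [exact: lin|exact: cphi].
- by apply: (@continuous_comp _ _ _ (fun z : R * R => (1 - a) * z.1 + a * z.2) phi); [exact: lin|exact: cphi].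
- exact: (continuous_fst2 cphi).
- exact: (continuous_snd2 cphi).
Qed.

Let mpsi : measurable_fun setT (fun z : rR * rR => psi z.1 z.2).
Proof.
have mphi : measurable_fun setT (phi : rR -> R) by exact: continuous_measurable_fun.
have lin (u v : R) : measurable_fun setT (fun z : rR * rR => u * z.1 + v * z.2 : R).
  by apply: measurable_funD; apply: measurable_funM => //; exact: measurable_cst.
apply: measurable_funM.
  apply: (measurableT_comp (f := fun x : rR => `|x : R| `^ gamma)).
    exact: (continuous_measurable_fun (continuous_normr_powR hgamma)).
  by apply: measurable_funB.
apply: measurable_funB; [apply: measurable_funB; [apply: measurable_funD|]|].
- exact: (measurableT_comp mphi (lin _ _)).
- exact: (measurableT_comp mphi (lin _ _)).
- exact: (measurableT_comp mphi measurable_fst).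
- exact: (measurableT_comp mphi measurable_snd).
Qed.

Let q t := collision a gamma (nu t) (nu t) phi.
Let Phi t := \int[nu t]_x phi x.

Let q_cvg t : 2^-1 * mean2 (S n t) psi @[n --> U] --> q t.
Proof.
apply: cvgM; first exact: cvg_cst.
exact: (nuS t s1 cpsi mpsi (rate_gain_bound ha hgamma (lexx 1) phi_wt)).2.
Qed.

Let Phi_cvg t : S n t phi @[n --> U] --> Phi t.
Proof. exact: (nu1 t (lexx 1) cphi phi_wt).2. Qed.

Let k_le n r t : r <= t -> (k n r <= k n t)%N.
Proof. by move=> rt; apply: Num.Theory.le_truncn; rewrite ler_wpM2r ?invr_ge0. Qed.

Let d_cvg r t : 0 <= r -> r <= t -> (k n t - k n r)%:R * h n @[n --> U] --> t - r.
Proof.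
move=> r0 rt.
have e n : (k n t - k n r)%:R * h n = (k n t)%:R * h n - (k n r)%:R * h n.
  by rewrite natrB ?mulrBl// k_le.
under eq_fun do rewrite e.
by apply: cvgB; apply: kh_cvg => //; exact: le_trans rt.
Qed.

Let Clip := K * (4 * 2 `^ (gamma / 2)) * A (1 + gamma / 2) * euler_lip gamma A (1 + gamma / 2).

Let q_lip r t : 0 <= r -> 0 <= t -> `|q t - q r| <= Clip * `|t - r|.
Proof.
wlog rt : r t / r <= t.
  move=> H r0 t0; have [rt|/ltW tr] := leP r t; first exact: H.
  by rewrite distrC [`|t - r|]distrC; exact: H.
move=> r0 t0; rewrite [`|t - r|]ger0_norm ?subr_ge0// [leRHS]mulrC.
have c1 : `|2^-1 * mean2 (S n t) psi - 2^-1 * mean2 (S n r) psi| @[n --> U] --> `|q t - q r|.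
  by apply: cvg_norm; apply: cvgB; exact: q_cvg.
have c2 : (k n t - k n r)%:R * h n * Clip @[n --> U] --> (t - r) * Clip.
  by apply: cvgM; [exact: d_cvg|exact: cvg_cst].
apply: (cvg_ler c1 c2) => n.
have := mean2_euler_lipschitz ha hgamma (mE0 n) (h_ge0 n) (hL n) (momA n) (k n r)
  (k n t - k n r) s1 (rate_gain_bound ha hgamma (lexx 1) phi_wt).
rewrite subnKC ?k_le// -/psi -mulrBr normrM ger0_norm//.
rewrite /Clip; lra.
Qed.

Let Ccurv := K * euler_curv gamma A 1.

Let taylor_fwd r t : 0 <= r -> r <= t ->
  `|Phi t - Phi r - (t - r) * q r| <= Ccurv * (t - r) ^+ 2.
Proof.
move=> r0 rt; rewrite [leRHS]mulrC.
have c1 : `|S n t phi - S n r phi - (k n t - k n r)%:R * h n * (2^-1 * mean2 (S n r) psi)|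
    @[n --> U] --> `|Phi t - Phi r - (t - r) * q r|.
  apply: cvg_norm; apply: cvgB; first by apply: cvgB; exact: Phi_cvg.
  by apply: cvgM; [exact: d_cvg|exact: q_cvg].
have c2 : ((k n t - k n r)%:R * h n) ^+ 2 * Ccurv @[n --> U] --> (t - r) ^+ 2 * Ccurv.
  by apply: cvgM; [apply: cvgM; exact: d_cvg|exact: cvg_cst].
apply: (cvg_ler c1 c2) => n.
have := euler_taylor ha hgamma (mE0 n) (h_ge0 n) (hL n) (momA n) (k n r)
  (k n t - k n r) (lexx 1) phi_wt.
by rewrite subnKC ?k_le.
Qed.

Let C := Ccurv + Clip.

Let Clip_ge0 : 0 <= Clip.
Proof. by have := q_lip (lexx 0) ler01; rewrite subr0 normr1 mulr1; apply: le_trans. Qed.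

Let Ccurv_ge0 : 0 <= Ccurv.
Proof.
by have := taylor_fwd (lexx 0) ler01; rewrite subr0 expr1n mulr1; apply: le_trans.
Qed.

Let taylor_both r t : 0 <= r -> 0 <= t ->
  `|Phi t - Phi r - (t - r) * q r| <= C * (t - r) ^+ 2.
Proof.
move=> r0 t0; rewrite [leRHS]mulrDl.
have [rt|/ltW tr] := leP r t.
  by apply: (le_trans (taylor_fwd r0 rt)); rewrite lerDl mulr_ge0 ?sqr_ge0.
rewrite (_ : _ - _ - _ = - (Phi r - Phi t - (r - t) * q t) + (t - r) * (q t - q r)); last by ring.
apply: (le_trans (ler_normD _ _)); rewrite normrN; apply: lerD.
  by rewrite -[(t - r) ^+ 2]sqrrN opprB; exact: taylor_fwd.
rewrite normrM -[(t - r) ^+ 2]real_normK ?num_real// expr2 [leRHS]mulrCA.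
by rewrite ler_wpM2l// q_lip.
Qed.

Let q_lipC r t : 0 <= r -> 0 <= t -> `|q t - q r| <= C * `|t - r|.
Proof.
move=> r0 t0; apply: (le_trans (q_lip r0 t0)).
by rewrite [leRHS]mulrDl lerDr mulr_ge0.
Qed.

Let Phi0 : Phi 0 = \int[mu0]_x phi x.
Proof.
have c0 := cvgU (E0_cvg (lexx 1) cphi phi_wt).
have e n : S n 0 phi = E0 n phi by rewrite /scheme_index mul0r Num.Theory.truncn0.
have := @Phi_cvg 0; under eq_fun do rewrite e.
by move=> c; exact: (cvg_unique _ c c0).
Qed.

(** The velocity [q] of the limit is Lipschitz and expands [Phi] to second
    order, because both properties hold along the scheme with constants that
    depend only on the moments. *)
Lemma nu_weak : [/\ {within `[0, +oo[, continuous q},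
  (forall T, 0 <= T -> (@lebesgue_measure R).-integrable `[0, T] (EFin \o q)) &
  forall t, 0 <= t -> \int[nu t]_x phi x =
    \int[mu0]_x phi x + \int[lebesgue_measure]_(s in `[0, t]) q s].
Proof.
split.
- exact: taylor_within q_lipC.
- by move=> T T0; case: (taylor_integral taylor_both q_lipC T0).
- by move=> t t0; rewrite -Phi0; case: (taylor_integral taylor_both q_lipC t0).
Qed.

End test_function.

Lemma nu_solution : measure_weak_solution a gamma mu0 (fun t => nu t : {finite_measure set rR -> \bar R}).
Proof.
have g0 := hgamma.
have U1 : 1 <= Upsilon gamma / 2.
  by rewrite ler_pdivlMr// mul1r /Upsilon le_max lexx orbT.
have bd x : `|wt (Upsilon gamma / 2) x| <= 1 * wt (Upsilon gamma / 2) x.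
  by rewrite mul1r ger0_norm// wt_ge0.
have cw := @continuous_wt R (Upsilon gamma / 2).
have fin t := @nu1 t _ _ _ U1 cw bd.
have i0 : mu0.-integrable setT (EFin \o (wt (Upsilon gamma / 2) : rR -> R)).
  exact: mom0.
have normE (P : probability rR R) : P.-integrable setT (EFin \o (wt (Upsilon gamma / 2) : rR -> R)) ->
    moment_norm (Upsilon gamma) P = (\int[P]_x wt (Upsilon gamma / 2) x)%:E.
  by move=> iP; rewrite /Rintegral fineK//; exact: integrable_fin_num iP.
split.
- by rewrite normE// ltry.
- by move=> t t0; rewrite normE ?ltry//; case: (fin t).
- move=> t t0; rewrite !normE//; last by case: (fin t).
  rewrite lee_fin; apply: (nu_noninc t U1 cw bd) => x y; exact: gain_wt.
- move=> t t0; split; last by rewrite mean0; exact: nu_mean_zero.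
  by transitivity (1%E : \bar R); [|apply/esym]; exact: probability_setT.
- by move=> phi cphi [K phiK]; exact: nu_weak cphi phiK.
Qed.

End from_scheme.

Lemma cooling_solution (mu0 : probability rR R) :
  (forall s, mu0.-integrable setT (EFin \o (wt s : rR -> R))) ->
  \int[mu0]_x (x : R) = 0 ->
  exists nu : R -> probability rR R, [/\
    measure_weak_solution a gamma mu0 (fun t => nu t : {finite_measure set rR -> \bar R}),
    forall p, 2 <= p -> exists2 D, 0 < D & forall t, 0 <= t ->
      (nu t).-integrable setT (EFin \o (fun x : rR => `|x : R| `^ p)) /\
      \int[nu t]_x (`|x : R| `^ p) <= (D / (1 + t)) `^ (p / gamma) &
    0 < (\int[mu0]_x `|x : R|) -> exists2 c, 0 < c & forall t, 0 <= t ->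
      c <= (\int[nu t]_x `|x : R|) * (1 + t) `^ gamma^-1].
Proof.
move=> mom0 mean0.
have [E0 [L [A [mE0 E0_id momA E0_cvg]]]] := initial_means mom0 mean0.
have [U [UU U_oo]] := @ultraFilterLemma nat \oo _.
pose S n t := euler a gamma (scheme_step L n) (E0 n) (scheme_index L n t).
have mS n t : is_mean (L n) (S n t).
  apply: (euler_mean ha hgamma (mE0 n)); [exact: scheme_step_ge0|exact: scheme_stepL].
have S_wt n t s : 1 <= s -> S n t (wt s) <= A s.
  move=> s1; apply: (euler_wt ha hgamma (mE0 n)) => //; first exact: scheme_step_ge0.
    exact: scheme_stepL.
  by move=> s' /momA.
have sol t : exists P, is_mean_limit U (fun n => S n t) P.
  exact: (helly UU (fun n => mS n t) (fun n => S_wt n t)).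
have /choice[nu nuS] := sol.
exists nu; split.
- exact: (nu_solution mom0 mean0 UU U_oo mE0 E0_id momA E0_cvg nuS).
- exact: (nu_decay UU mE0 E0_id momA nuS).
- exact: (nu_lower UU U_oo mE0 E0_id momA E0_cvg nuS).
Qed.
End solution.

(** * Distance to the Dirac mass *)
Section distance_to_dirac.
Context {R : realType}.
Local Notation rR := (measurableTypeR R).
Implicit Types (nu : {measure set rR -> \bar R}) (p s t x : R).

Let dirac0 := @dirac _ rR 0 R.

Let dirac0E (B : set rR) : dirac0 B = ((0 : R) \in B)%:R%:E.
Proof. exact: diracE. Qed.

Lemma measurable_normr_powR p : measurable_fun setT (fun x : rR => `|x : R| `^ p).
Proof.
apply: (measurableT_comp (measurable_powR p)).
by apply: continuous_measurable_fun; exact: norm_continuous.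
Qed.

(** A coupling with a Dirac mass is carried by a horizontal line, so that all
    couplings have the same cost; there is one because [nu] has mass one. *)
Lemma Wasserstein_dirac p nu : nu setT = 1%E ->
  Wasserstein p nu dirac0 = poweR (\int[nu]_x (`|x : R| `^ p)%:E)%E p^-1.
Proof.
move=> nu1; rewrite /Wasserstein; congr (poweR _ _).
set S := (X in ereal_inf X).
suff -> : S = [set (\int[nu]_x (`|x : R| `^ p)%:E)%E] by rewrite ereal_inf1.
have cost (pi : {measure set (rR * rR)%type -> \bar R}) : is_coupling nu dirac0 pi ->
    (\int[pi]_z (`|z.1 - z.2| `^ p)%:E = \int[nu]_x (`|x : R| `^ p)%:E)%E.
  move=> [pi1 pi2].
  have law1 (A : set rR) : measurable A -> pi (fst @^-1` A) = nu A.
    move=> mA; rewrite -pi1//; congr (pi _).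
    by apply/seteqP; split => [[x y] /= Ax|[x y] /= [Ax _]].
  rewrite -(ge0_integral_law measurable_fst law1 (measurable_normr_powR p)); last first.
    by move=> x; exact: powR_ge0.
  apply: ae_eq_integral => //.
  - apply/measurable_EFinP; apply: (measurableT_comp (measurable_normr_powR p)).
    exact: measurable_funB.
  - apply/measurable_EFinP.
    exact: (measurableT_comp (measurable_normr_powR p) measurable_fst).
  - exists (setT `*` ~` [set 0]); split.
    + by apply: measurableX => //; exact: measurableC.
    + rewrite pi2; last exact: measurableC.
      by rewrite -[LHS]/(dirac0 (~` [set 0])) dirac0E memNset// => /(_ erefl).
    + move=> [x y] /= h; split => // y0; apply: h => _.
      by rewrite /= y0 subr0.
apply/seteqP; split => [_ [pi /cost <- <-]//|_ ->].
have mj : measurable_fun setT (fun x : rR => (x, 0) : rR * rR).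
  by apply: measurable_fun_pair => //; exact: measurable_cst.
have [pi0 pi0E] : exists pi0 : {measure set (rR * rR)%type -> \bar R},
    forall A, pi0 A = nu ((fun x : rR => (x, 0)) @^-1` A).
  unshelve eexists (pushforward nu (fun x : rR => (x, 0) : rR * rR)); first exact: mj.
  by [].
have cpl : is_coupling nu dirac0 pi0.
  split => [A mA|B mB]; rewrite pi0E.
    by congr (nu _); apply/seteqP; split => x //= [].
  rewrite -[RHS]/(dirac0 B) dirac0E; have [B0|B0] := boolP ((0 : R) \in B).
    rewrite -[RHS]nu1; congr (nu _); apply/seteqP; split => // x _ /=.
    by split => //; move: B0; rewrite inE.
  rewrite -[RHS](measure0 nu); congr (nu _).
  by apply/seteqP; split => // x /= [_ Bx]; move: B0; rewrite mem_set.
by exists pi0; [exact: cpl|exact: (cost pi0 cpl)].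
Qed.

Lemma Rintegral_jensen (P : probability rR R) (f : rR -> R) s : 1 <= s ->
  (forall x, 0 <= f x) -> P.-integrable setT (EFin \o f) ->
  P.-integrable setT (EFin \o (fun x => f x `^ s)) ->
  (\int[P]_x f x) `^ s <= \int[P]_x (f x `^ s).
Proof.
move=> s1 f0 fi fsi; set m := Rintegral _ _ _.
have m0 : 0 <= m by apply: Rintegral_ge0 => x _; exact: f0.
have P1 : fine (P setT) = 1 :> R by rewrite -[RHS]/(fine 1%:E); congr fine; exact: probability_setT.
have ci (k : R) : P.-integrable setT (EFin \o (fun=> k)).
  by apply: (@bounded_integrable _ _ _ P (probability_setT P) _ `|k|) => //; exact: measurable_cst.
have fmi : P.-integrable setT (EFin \o (fun x => f x - m)).
  exact: (integrableB measurableT fi (ci m)).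
have smi : P.-integrable setT (EFin \o (fun x => s * m `^ (s - 1) * (f x - m))).
  exact: (integrableZl measurableT _ fmi).
have <- : \int[P]_x (m `^ s + s * m `^ (s - 1) * (f x - m)) = m `^ s.
  rewrite RintegralD// (RintegralZl _ measurableT fmi) RintegralB//.
  by rewrite !Rintegral_cst// P1 !mulr1 -/m subrr mulr0 addr0.
apply: le_Rintegral => //.
  exact: (integrableD measurableT (ci (m `^ s)) smi).
by move=> x _; exact: powR_tangent.
Qed.

(** A vanishing first moment confines the mass to the origin. *)
Lemma normr_integral_gt0 (P : probability rR R) :
  P.-integrable setT (EFin \o (fun x : rR => `|x : R|)) ->
  ~ meas_eq P dirac0 -> 0 < (\int[P]_x `|x : R|).
Proof.
move=> iP neq; rewrite lt0r Rintegral_ge0 ?andbT//; apply/negP => /eqP I0.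
apply: neq => A mA.
have J0 : (\int[P]_(x in setT) `|(x : R)%:E| = 0)%E.
  have := integrable_fin_num measurableT iP.
  by move=> /fineK <-; congr EFin.
have [N [mN PN Nsub]] : {ae P, forall x, setT x -> (EFin \o (id : rR -> R)) x = 0%E}.
  by apply/(ae_eq_integral_abs P measurableT _).1 => //; exact/measurable_EFinP.
have N0 x : ~ N x -> (x : R) = 0.
  move=> Nx; apply: contrapT => x0; apply: Nx; apply: Nsub => /= h.
  by apply: x0; have := h I => -[].
have null (B : set rR) : measurable B -> ~ B 0 -> P B = 0%E.
  move=> mB B0; apply: (subset_measure0 mB mN _ PN) => x Bx.
  by apply: contrapT => /N0 x0; apply: B0; rewrite -x0.
rewrite -[RHS]/(dirac0 A) dirac0E; have [A0|A0] := boolP ((0 : R) \in A).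
  have nA : P (~` A) = 0%E.
    by apply: null; [exact: measurableC|move: A0; rewrite inE => A0 /(_ A0)].
  by have := probability_setC P (measurableC mA); rewrite setCK nA sube0.
by apply: null => // A0'; move: A0; rewrite mem_set.
Qed.

End distance_to_dirac.

(** * Moments of the initial datum *)
Section exponential_moment.
Context {R : realType}.
Implicit Types (eps gamma s u x : R).

Lemma expr_le_expR (N : nat) u : 0 <= u -> u ^+ N <= N%:R ^+ N * expR u.
Proof.
move=> u0; case: N => [|N]; first by rewrite !expr0 mul1r -expR0 ler_expR.
have N0 : 0 < N.+1%:R :> R by [].
have -> : expR u = expR (u / N.+1%:R) ^+ N.+1.
  by rewrite -expRM_natl mulrC divfK ?gt_eqF.
rewrite -exprMn lerXn2r ?nnegrE ?mulr_ge0 ?expR_ge0//.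
have := expR_ge1Dx (u / N.+1%:R) => h.
have := ler_wpM2l (ltW N0) h; rewrite mulrDr mulr1 mulrC divfK ?gt_eqF//.
by apply: le_trans; rewrite lerDr.
Qed.

Lemma wt_le_expR eps gamma s : 0 < eps -> 0 < gamma ->
  exists C, forall x, wt s x <= C * expR (eps * `|x| `^ gamma).
Proof.
move=> e0 g0; pose N := (Num.truncn (2 * `|s| / gamma)).+1.
have gN : 2 * `|s| <= gamma * N%:R.
  have : 0 <= 2 * `|s| / gamma by rewrite divr_ge0 ?mulr_ge0// ltW.
  move=> /Num.Theory.truncn_itv/andP[_]; rewrite ltr_pdivrMr// -/N [leRHS]mulrC.
  exact: ltW.
pose Q := (N%:R / eps) ^+ N.
have Q0 : 0 <= Q by rewrite exprn_ge0// divr_ge0// ltW.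
exists (2 `^ `|s| * (1 + Q)) => x.
have E1 : 1 <= expR (eps * `|x| `^ gamma).
  by rewrite -[leLHS]expR0 ler_expR mulr_ge0 ?powR_ge0// ltW.
have t0 : 0 <= 2 `^ `|s| :> R by exact: powR_ge0.
apply: (le_trans (wt_le x (ler_norm s))); rewrite -mulrA.
have [x1|x1] := leP `|x| 1.
  apply: (@le_trans _ _ (2 `^ `|s| * 1)).
    rewrite mulr1 /wt; apply: ler_powR_base => //; first by rewrite ltW// wtb_gt0.
    by rewrite -[x ^+ 2]real_normK ?num_real//; have := normr_ge0 x; nra.
  by rewrite ler_wpM2l//; nra.
apply: (@le_trans _ _ (2 `^ `|s| * (x ^+ 2) `^ `|s|)).
  rewrite -powRM ?sqr_ge0//; apply: ler_powR_base => //; first by rewrite ltW// wtb_gt0.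
  by rewrite -[x ^+ 2]real_normK ?num_real//; nra.
rewrite ler_wpM2l//.
have -> : (x ^+ 2) `^ `|s| = `|x| `^ (2 * `|s|).
  by rewrite normr_powR_sqr; congr (_ `^ _); field.
apply: (@le_trans _ _ (`|x| `^ (gamma * N%:R))); first by rewrite ler_powR// ltW.
rewrite powRrM powR_mulrn ?powR_ge0//.
have u0 : 0 <= eps * `|x| `^ gamma by rewrite mulr_ge0 ?powR_ge0// ltW.
have := expr_le_expR N u0; rewrite exprMn => h.
have eN : 0 < eps ^+ N by rewrite exprn_gt0.
have h2 : (`|x| `^ gamma) ^+ N <= Q * expR (eps * `|x| `^ gamma).
  by rewrite -(ler_pM2l eN) (le_trans h)// /Q expr_div_n mulrA [_ * (_ / _)]mulrC divfK ?gt_eqF.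
by rewrite (le_trans h2)// ler_wpM2r ?expR_ge0// lerDr.
Qed.

Lemma exp_moment_integrable (P : probability (measurableTypeR R) R) gamma s :
  0 < gamma -> in_Pexp gamma P ->
  P.-integrable setT (EFin \o (wt s : measurableTypeR R -> R)).
Proof.
move=> g0 [_ [eps e0 fin]]; have [C HC] := wt_le_expR s e0 g0.
have mg : measurable_fun setT (fun x : measurableTypeR R => expR (eps * `|x : R| `^ gamma)).
  apply: measurableT_comp => //; apply: measurable_funM; first exact: measurable_cst.
  exact: measurable_normr_powR.
have ig : P.-integrable setT (EFin \o (fun x : measurableTypeR R => expR (eps * `|x : R| `^ gamma))).
  apply/integrableP; split; first exact/measurable_EFinP.
  by under eq_integral do rewrite /= ger0_norm ?expR_ge0//.
apply: (le_integrable measurableT _ _ (integrableZl measurableT C ig)).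
  by apply/measurable_EFinP; exact: measurable_wt.
move=> x _ /=; rewrite lee_fin (ger0_norm (wt_ge0 _ _)).
by apply: (le_trans (HC x)); exact: ler_norm.
Qed.

End exponential_moment.

(** * Cooling *)
Section haff.
Context {R : realType} (gamma : R) (P : R -> probability (measurableTypeR R) R).
Local Notation rR := (measurableTypeR R).
Implicit Types (p t x K : R).
Hypotheses (hgamma : 0 < gamma) (decay : forall p, 2 <= p -> exists2 D, 0 < D &
  forall t, 0 <= t -> (P t).-integrable setT (EFin \o (fun x : rR => `|x : R| `^ p)) /\
    \int[P t]_x (`|x : R| `^ p) <= (D / (1 + t)) `^ (p / gamma)).

(** By Jensen's inequality, from the exponent [2 p]. *)
Lemma moment_decay p : 1 <= p -> exists2 D, 0 < D & forall t, 0 <= t ->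
  (P t).-integrable setT (EFin \o (fun x : rR => `|x : R| `^ p)) /\
  \int[P t]_x (`|x : R| `^ p) <= (D / (1 + t)) `^ (p / gamma).
Proof.
move=> p1; have p2 : 2 <= 2 * p by lra.
have [D D0 HD] := decay p2; exists D => // t t0; have [i2 m2] := HD t t0.
have sq x : `|x| `^ (2 * p) = (`|x| `^ p) ^+ 2.
  by rewrite mulrC powRrM powR_mulrn// powR_ge0.
have i1 : (P t).-integrable setT (EFin \o (fun x : rR => `|x : R| `^ p)).
  have c1 : (P t).-integrable setT (EFin \o (fun _ : rR => 1 : R)).
    apply: (@bounded_integrable _ _ _ _ (probability_setT (P t)) _ 1) => [|x]; last by rewrite normr1.
    exact: measurable_cst.
  apply: (le_integrable measurableT _ _ (integrableD measurableT c1 i2)).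
    by apply/measurable_EFinP; exact: measurable_normr_powR.
  move=> x _ /=; rewrite lee_fin sq [leLHS]ger0_norm ?powR_ge0//.
  rewrite [leRHS]ger0_norm; last by rewrite addr_ge0 ?sqr_ge0.
  by have := powR_ge0 `|x : R| p; nra.
split => //.
have e x : (`|x| `^ p) `^ 2 = `|x| `^ (2 * p) by rewrite -powRrM mulrC.
have i2' : (P t).-integrable setT (EFin \o (fun x : rR => (`|x : R| `^ p) `^ 2)).
  by under [X in EFin \o X]eq_fun do rewrite e.
have := Rintegral_jensen (ler1n R 2) (fun x : rR => powR_ge0 `|x : R| p) i1 i2'.
under [X in _ <= X]eq_Rintegral do rewrite e.
move=> /le_trans/(_ m2).
have M0 : 0 <= \int[P t]_x (`|x : R| `^ p) by apply: Rintegral_ge0 => x _; exact: powR_ge0.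
have h2 : 0 <= 2^-1 :> R by rewrite invr_ge0.
move/(ler_powR_base h2 (powR_ge0 _ _)).
rewrite -!powRrM mulfV// powRr1// => /le_trans; apply.
by rewrite (_ : 2 * p / gamma / 2 = p / gamma)//; field; rewrite gt_eqF.
Qed.

Lemma moment_cvg0 p e : 1 <= p -> 0 < e ->
  \forall t \near +oo, \int[P t]_x (`|x : R| `^ p) <= e.
Proof.
move=> p1 e0; have g0 := hgamma.
have [D D0 HD] := moment_decay p1.
have p0 : 0 < p by lra.
have pg : 0 < p / gamma by rewrite divr_gt0.
near=> t.
have t0 : 0 <= t by near: t; exact: nbhs_pinfty_ge.
have [_ /le_trans] := HD t t0; apply.
have tD : D / e `^ (p / gamma)^-1 <= t by near: t; apply: nbhs_pinfty_ge; exact: num_real.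
have eE : e = (e `^ (p / gamma)^-1) `^ (p / gamma).
  by rewrite -powRrM mulVf ?gt_eqF// powRr1// ltW.
rewrite [leRHS]eE.
have E0 : 0 < e `^ (p / gamma)^-1 by exact: powR_gt0.
apply: ler_powR_base; rewrite ?(ltW pg)// ?divr_ge0 ?(ltW D0)//; first lra.
move: tD; rewrite ler_pdivrMr// => tD.
by rewrite ler_pdivrMr; [nra|lra].
Unshelve. all: by end_near. Qed.

(** Away from the origin the increment [phi x - phi 0] is bounded by a multiple
    of [|x|^p], near the origin it is small. *)
Lemma cooling_weak_star p (phi : R -> R) : 1 <= p -> continuous phi ->
  (exists K, forall x, `|phi x| <= K * (1 + `|x| `^ p)) ->
  \int[P t]_x phi x @[t --> +oo] --> phi 0.
Proof.
move=> p1 cphi [K phiK].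
have p0 : 0 < p by lra.
have K0 : 0 <= K.
  have := phiK 0; rewrite normr0 powR0 ?gt_eqF// addr0 mulr1.
  exact: le_trans.
have mphi : measurable_fun setT (phi : rR -> R) by exact: continuous_measurable_fun.
apply/cvgrPdist_le => e e0.
have e2 : 0 < e / 2 by rewrite divr_gt0.
have /cvgrPdist_le/(_ _ e2)[d /= d0 dP] := cphi 0.
pose M := K * (2 / d `^ p + 1).
have dp0 : 0 < d `^ p by exact: powR_gt0.
have M0 : 0 <= M by rewrite mulr_ge0// addr_ge0// divr_ge0// ltW.
have bd x : `|phi x - phi 0| <= e / 2 + M * `|x| `^ p.
  have xp : 0 <= `|x| `^ p by exact: powR_ge0.
  have [xd|dx] := ltP `|x| d.
    have := dP x; rewrite /= sub0r normrN => /(_ xd).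
    by rewrite distrC => /le_trans; apply; rewrite lerDl mulr_ge0.
  have h1 : 1 <= `|x| `^ p / d `^ p.
    by rewrite ler_pdivlMr// mul1r; apply: ler_powR_base => //; exact: ltW.
  have k0 : `|phi 0| <= K by have := phiK 0; rewrite normr0 powR0 ?gt_eqF// addr0 mulr1.
  have kx := phiK x.
  apply: (le_trans (ler_normB _ _)).
  have : K * (2 + `|x| `^ p) <= M * `|x| `^ p.
    rewrite /M -mulrA ler_wpM2l// mulrDl mul1r lerD2r mulrAC -mulrA.
    lra.
  lra.
have Me : 0 < e / 2 / (M + 1) by rewrite divr_gt0// ltr_wpDl.
near=> t.
have t0 : 0 <= t by near: t; exact: nbhs_pinfty_ge.
have small : \int[P t]_x (`|x : R| `^ p) <= e / 2 / (M + 1).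
  by near: t; exact: moment_cvg0.
have [D D0 HD] := moment_decay p1; have [ip _] := HD t t0.
have P1 : fine (P t setT) = 1 :> R.
  by rewrite -[RHS]/(fine 1%:E); congr fine; exact: probability_setT.
have ci (k : R) : (P t).-integrable setT (EFin \o (fun _ : rR => k)).
  by apply: (@bounded_integrable _ _ _ _ (probability_setT (P t)) _ `|k|) => //; exact: measurable_cst.
have iM : (P t).-integrable setT (EFin \o (fun x : rR => M * `|x : R| `^ p)).
  exact: (integrableZl measurableT M ip).
have iS : (P t).-integrable setT (EFin \o (fun x : rR => e / 2 + M * `|x : R| `^ p)).
  exact: (integrableD measurableT (ci (e / 2)) iM).
have id : (P t).-integrable setT (EFin \o (fun x : rR => phi x - phi 0)).
  apply: (le_integrable measurableT _ _ iS).
    by apply/measurable_EFinP; apply: measurable_funB => //; exact: measurable_cst.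
  move=> x _ /=; rewrite lee_fin [leRHS]ger0_norm; first exact: bd.
  by rewrite addr_ge0 ?(ltW e2)// mulr_ge0 ?powR_ge0.
have -> : \int[P t]_x phi x = phi 0 + \int[P t]_x (phi x - phi 0).
  rewrite -[X in X + _](mulr1 (phi 0)) -P1 -(Rintegral_cst (P t) measurableT) -RintegralD//.
  by apply: eq_Rintegral => x _; rewrite addrC subrK.
rewrite opprD addrA subrr sub0r normrN.
apply: (le_trans (le_normr_Rintegral measurableT id)).
apply: (@le_trans _ _ (\int[P t]_x (e / 2 + M * `|x : R| `^ p))).
  by apply: le_Rintegral => //; exact: (integrable_norm id).
rewrite RintegralD// Rintegral_cst// P1 mulr1 (RintegralZl M measurableT ip).
have : M * (\int[P t]_x (`|x : R| `^ p)) <= M * (e / 2 / (M + 1)) by rewrite ler_wpM2l.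
have : (M + 1) * (e / 2 / (M + 1)) = e / 2 by rewrite mulrC divfK// gt_eqF// ltr_wpDl.
lra.
Unshelve. all: by end_near. Qed.

End haff.

Theorem corollary3p6 (R : realType) (a gamma : R)
    (ha : 0 < a < 1) (hgamma : 0 < gamma)
    (mu0 : probability (measurableTypeR R) R)
    (hP0 : in_P0 mu0) (hexp : in_Pexp gamma mu0)
    (mu : R -> {finite_measure set (measurableTypeR R) -> \bar R})
    (hmu : unique_measure_weak_solution a gamma mu0 mu) :
  exists2 C : R, 0 < C &
    forall p : R, 1 <= p ->
      let delta0 := @dirac _ (measurableTypeR R) 0 R in
      let W := fun t => Wasserstein p (mu t) delta0 in
      let rate := fun t => ((1 + C * t) `^ (- gamma^-1))%:E in
      [/\ forall t, 0 <= t -> in_Pp p (mu t),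
          weak_star_cvg p mu delta0,
          dominated_pinfty W rate &
          ~ meas_eq mu0 delta0 -> same_order_pinfty W rate].
Proof.
have [_ i0 m0] := hP0.
have mom0 s := exp_moment_integrable s hgamma hexp.
have [nu [nu_sol decay lower]] := cooling_solution ha hgamma mom0 m0.
have nu_mu t : 0 <= t -> meas_eq (nu t) (mu t) by exact: hmu.2 nu_sol t.
have int_mu t (f : R -> \bar R) : 0 <= t -> (\int[mu t]_x f x = \int[nu t]_x f x)%E.
  by move=> t0; apply: eq_measure_integral => A mA _; rewrite nu_mu.
(* Rates with different constants [C] are of the same order. *)
exists 1 => // p p1 delta0 W rate.
have p0 : 0 < p by lra.
have [D D0 HD] := moment_decay hgamma decay p1.
have gi : 0 < gamma^-1 by rewrite invr_gt0.
have mu1 t : 0 <= t -> mu t setT = 1%E.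
  by move=> t0; rewrite -nu_mu//; exact: probability_setT.
pose m t := \int[nu t]_x (`|x : R| `^ p).
have m_ge0 t : 0 <= m t by apply: Rintegral_ge0 => x _; exact: powR_ge0.
have mE t : 0 <= t -> (\int[mu t]_x (`|x : R| `^ p)%:E = (m t)%:E)%E.
  move=> t0; have [ip _] := HD t t0.
  by rewrite int_mu// /m /Rintegral fineK//; exact: (integrable_fin_num measurableT ip).
have WE t : 0 <= t -> W t = (m t `^ p^-1)%:E.
  move=> t0; rewrite /W (Wasserstein_dirac p (mu1 t t0)) -poweR_EFin.
  by congr (poweR _ _); exact: mE.
have W_le t : 0 <= t -> m t `^ p^-1 <= D `^ gamma^-1 * (1 + 1 * t) `^ (- gamma^-1).
  move=> t0; have t1 : 0 <= 1 + t by lra.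
  have [_ mD] := HD t t0.
  have pi : 0 <= p^-1 by rewrite invr_ge0 ltW.
  apply: (le_trans (ler_powR_base pi (m_ge0 t) mD)).
  rewrite -powRrM (_ : p / gamma / p = gamma^-1); last by field; rewrite !gt_eqF.
  by rewrite powRM ?invr_ge0 ?(ltW D0)// mul1r powRN -[(1 + t)^-1]powR_inv1// -powRrM mulN1r powRN.
have W_dom : dominated_pinfty W rate.
  exists (D `^ gamma^-1); first exact: powR_gt0.
  near=> t.
  have t0 : 0 <= t by near: t; exact: nbhs_pinfty_ge.
  by rewrite WE// /rate -EFinM lee_fin W_le.
split => //.
- move=> t t0; split; first exact: mu1.
  by rewrite mE// ltry.
- move=> phi cphi phiK.
  have -> : \int[delta0]_x phi x = phi 0.
    rewrite /Rintegral integral_dirac//; last first.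
      by apply/measurable_EFinP; exact: continuous_measurable_fun.
    by rewrite diracT mul1e.
  have := cooling_weak_star hgamma decay p1 cphi phiK.
  apply: cvg_trans; apply: near_eq_cvg; near=> t.
  have t0 : 0 <= t by near: t; exact: nbhs_pinfty_ge.
  by rewrite /Rintegral int_mu.
move=> neq; split => //.
have mom1 : mu0.-integrable setT (EFin \o (fun x : measurableTypeR R => `|x : R|)).
  apply/integrableP; split; first by apply/measurable_EFinP; exact: measurableT_comp.
  by under eq_integral do rewrite /= normr_id.
have [c c0 Hc] := lower (normr_integral_gt0 mom1 neq).
exists c^-1; first by rewrite invr_gt0.
near=> t.
have t0 : 0 <= t by near: t; exact: nbhs_pinfty_ge.
rewrite WE// /rate -EFinM lee_fin mul1r.
have [D1 _ HD1] := moment_decay hgamma decay (lexx 1).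
have e1 (x : R) : `|x| `^ 1 = `|x| by rewrite powRr1.
have i1 : (nu t).-integrable setT (EFin \o (fun x : measurableTypeR R => `|x : R|)).
  by have [i1 _] := HD1 t t0; move: i1; under [X in EFin \o X]eq_fun do rewrite e1.
have [ip _] := HD t t0.
have jen := Rintegral_jensen p1 (fun x : measurableTypeR R => normr_ge0 (x : R)) i1 ip.
set m1 := Rintegral _ _ _ in jen.
have m10 : 0 <= m1 by apply: Rintegral_ge0.
have m1m : m1 <= m t `^ p^-1.
  have pi : 0 <= p^-1 by rewrite invr_ge0 ltW.
  have := ler_powR_base pi (powR_ge0 _ _) jen.
  by rewrite -powRrM mulfV ?gt_eqF// powRr1.
have t1 : 0 < 1 + t by rewrite ltr_pwDl.
rewrite powRN -[leLHS]mul1r ler_pdivrMr ?powR_gt0//.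
rewrite -(ler_pM2l c0) mulr1 !mulrA mulfV ?gt_eqF// mul1r.
by apply: (le_trans (Hc t t0)); rewrite ler_wpM2r ?powR_ge0.
Unshelve. all: by end_near. Qed.
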